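(* The Landau–Ginzburg model $(\check{\mathbb X}^\circ,W^{\rm eq}_q)$ is isomorphic to the equivariant Lie-theoretic Landau–Ginzburg model $(\mathcal R,\mathcal F^{\rm eq}_q)$ via the maps $$\check{\mathbb X}^\circ\times\mathbb C^*_q\xleftarrow{\ \pi_L\times\mathrm{id}\ }\bigl(B_-\cap U_+\dot w_P\dot w_0^{-1}U_+\bigr)\times\mathbb C_q^*\xrightarrow{\ \pi_R\times\mathrm{id}\ }\mathcal R\times\mathbb C_q^*,$$ that is, $\pi_L$ and $\pi_R$ are isomorphisms and $W^{\rm eq}\circ(\pi_L\times\mathrm{id})=\mathcal F^{\rm eq}\circ(\pi_R\times\mathrm{id})$ as multivalued maps to $\mathbb C\oplus\mathfrak h$.
   Context: Fix $1\le k\le n-1$. Group notation. In $G=GL_n(\mathbb C)$: $B_\pm$ are the upper/lower triangular Borel subgroups with unipotent radicals $U_\pm$, $T$ is the diagonal torus with Lie algebra $\mathfrak h$, $x_i(t)=\exp(tE_{i,i+1})$, $y_i(t)=\exp(tE_{i+1,i})$, $\dot s_i=x_i(1)y_i(-1)x_i(1)$, $\dot w=\dot s_{i_1}\cdots\dot s_{i_m}$ for a reduced expression of $w\in S_n$. $P\supset B_+$ is the parabolic generated by $B_+$ and the $\dot s_i$, $i\ne n-k$; $w_P$ is the longest element of $\langle s_i\mid i\neq n-k\rangle$, $w_0$ that of $S_n$. $\widetilde T^{W_P}=\{\mathrm{diag}(d,\dots,d,1,\dots,1)\mid d\in\mathbb C^*\}$ ($n-k$ entries $d$), $\alpha_{n-k}(t)=d$.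 $\mathcal R=(B_+\dot w_PB_-\cap B_-\dot w_0B_-)/B_-\subset GL_n/B_-$. Mirror. $\mathcal P_{k,n}$ is the set of Young diagrams $\lambda$ in a rectangle with $n-k$ rows and $k$ columns. Place $\lambda$ in the top-left corner; its boundary is a lattice path from the top right to the bottom left corner of the rectangle with $k$ horizontal and $n-k$ vertical steps; $J_\lambda\subset\{1,\dots,n\}$ is the set of positions of the horizontal steps, numbered from the top right. $\check{\mathbb X}=Gr_k((\mathbb C^n)^* )=P\backslash GL_n$, where $Pg$ is the span of the last $k$ rows of $g$; $p_\lambda$ is the Plücker coordinate given by the minor with column set $J_\lambda$. Indices are taken modulo $n$; $\mu_i,\widehat\mu_i$ ($1\le i\le n$) are the partitions with $J_{\mu_i}=\{i+1,\dots,i+k\}$, $J_{\widehat\mu_i}=\{i+1,\dots,i+k-1\}\cup\{i+k+1\}$. $\check{\mathbb X}^\circ=\{p_{\mu_i}\ne0\ \forall i\}$, with the normalisation $p_\emptyset=p_{\mu_n}=1$. $W=\sum_{i=1}^n\frac{p_{\widehat\mu_i}}{p_{\mu_i}}q^{\delta_{i,n-k}}$. Equivariant parameters. Let $T^\vee$ be the diagonal torus of the Langlands dual group $GL_n^\vee(\mathbb C)$, acting on $\mathbb C^n$ with standard basis $v_1,\dots,v_n$, and let $\mathfrak h^\vee$ be its Lie algebra, so that $\mathfrak h=(\mathfrak h^\vee)^*$. Let $\varepsilon_i^\vee\in(\mathfrak h^\vee)^*=\mathfrak h$ be the weight of $T^\vee$ on the span of $v_i$; $\varepsilon_1^\vee,\dots,\varepsilon_n^\vee$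 is the usual basis of $\mathfrak h$ (the diagonal matrix units $E_{ii}$). The parameters $x_1,\dots,x_n$ are the standard generators of $H^*_{T^\vee}(pt)=\mathbb C[x_1,\dots,x_n]$, and $\mathfrak h$ is identified with $H^2_{T^\vee}(pt)=\bigoplus_i\mathbb Cx_i$ by $x_i=-\varepsilon_i^\vee$. Thus $x_{i+1}-x_i$ is the simple coroot $\alpha_i^\vee=\varepsilon_i^\vee-\varepsilon_{i+1}^\vee$ and $x_1+\dots+x_{n-k}=-(\varepsilon_1^\vee+\dots+\varepsilon_{n-k}^\vee)$. Equivariant superpotentials. The multivalued map $W^{\rm eq}:\check{\mathbb X}^\circ\times\mathbb C_q^*\dashrightarrow\mathbb C\oplus\mathfrak h$ is $$W^{\rm eq}=W+\ln(q)(x_1+\dots+x_{n-k})+\sum_{i=1}^{n-1}\ln(p_{\mu_i})(x_{i+1}-x_i).$$ For $b=u_1t\dot w_P\dot w_0^{-1}u_2\in B_-$ with $u_1,u_2\in U_+$, $t\in\widetilde T^{W_P}$, put $\psi_R(b)=(b\dot w_0B_-,\alpha_{n-k}(t))$; this is an isomorphism $B_-\cap U_+\widetilde T^{W_P}\dot w_P\dot w_0^{-1}U_+\to\mathcal R\times\mathbb C_q^*$. The multivalued map $\mathcal F^{\rm eq}:\mathcal R\times\mathbb C_q^*\dashrightarrow\mathbb C\oplus\mathfrak h$ is $\mathcal F^{\rm eq}=\mathcal F+\Phi$, where $\mathcal F(\psi_R(b))=\sum_{i=1}^{n-1}(u_1)_{i,i+1}+\sum_{i=1}^{n-1}(u_2)_{i,i+1}$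 (well defined) and $\Phi(\psi_R(b))=\ln_T(\pi(b))\in\mathfrak h$, with $\pi:B_-=TU_-\to T$ the projection to the torus factor and $\ln_T:T\dashrightarrow\mathfrak h$ the multivalued inverse of $\exp$. The subscript $q$ denotes restriction to fixed $q$. Maps. For $b\in B_-\cap U_+\dot w_P\dot w_0^{-1}U_+$: $\pi_L(b)=Pb\in\check{\mathbb X}^\circ$ and $\pi_R(b)=b\dot w_0B_-\in\mathcal R$.
   Formalization: False as stated already for n=2, k=1; proved with π_R(b) replaced in the identity by t_q b ẇ_0 B_- (t_q=diag(q,…,q,1,…,1), also shown an isomorphism onto R for each q), with x_i=+ε_i^∨ instead of −ε_i^∨, and with multivalued equality taken modulo ker(exp). *)

(* Defs.v *)
From HB Require Import structures.
From mathcomp Require Import all_boot all_order all_algebra.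
From mathcomp Require Import fingroup perm.
From mathcomp Require Import all_classical all_reals all_analysis.
From mathcomp Require Import complex.

Set Implicit Arguments.
Unset Strict Implicit.
Unset Printing Implicit Defensive.

Import Order.TTheory GRing.Theory Num.Theory.
Import numFieldNormedType.Exports.

Local Open Scope classical_set_scope.
Local Open Scope complex_scope.
Local Open Scope ring_scope.

(** * Varieties as spaces with functions *)

(* A set of points [fpts] with its Zariski-open subsets and, for each open U,
   the functions regular on U.  Functions are total on the carrier; only their
   values on U matter. *)
Record fspace (K : Type) := FSpace {
  fcarrier : Type;
  fpts : set fcarrier;
  fopen : set (set fcarrier);
  freg : set fcarrier -> set (fcarrier -> K) }.

Arguments fcarrier {K} X : rename.
Arguments fpts {K} X _ : rename.
Arguments fopen {K} X _ : rename.
Arguments freg {K} X _ _ : rename.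

Definition fmorph (K : Type) (X Y : fspace K)
    (phi : fcarrier X -> fcarrier Y) : Prop :=
  (forall x, fpts X x -> fpts Y (phi x)) /\
  (forall U, fopen Y U ->
    fopen X (fpts X `&` phi @^-1` U) /\
    (forall f, freg Y U f -> freg X (fpts X `&` phi @^-1` U) (f \o phi))).

Definition fiso (K : Type) (X Y : fspace K)
    (phi : fcarrier X -> fcarrier Y) : Prop :=
  fmorph phi /\
  exists psi : fcarrier Y -> fcarrier X,
    [/\ fmorph psi,
        (forall x, fpts X x -> psi (phi x) = x) &
        (forall y, fpts Y y -> phi (psi y) = y)].

Inductive mxpolyfun (K : fieldType) (m n : nat) : ('M[K]_(m, n) -> K) -> Prop :=
| MxPolyConst c : mxpolyfun (fun=> c)
| MxPolyCoord i j : mxpolyfun (fun A => A i j)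
| MxPolyAdd f g : mxpolyfun f -> mxpolyfun g -> mxpolyfun (fun A => f A + g A)
| MxPolyMul f g : mxpolyfun f -> mxpolyfun g -> mxpolyfun (fun A => f A * g A).

Definition mxspace (K : fieldType) (m n : nat) : fspace K :=
  @FSpace K 'M[K]_(m, n) setT
    (fun U => forall x, U x -> exists h,
       [/\ mxpolyfun h, h x != 0 & forall y, h y != 0 -> U y])
    (fun U f => forall x, U x -> exists g h,
       [/\ mxpolyfun g, mxpolyfun h, h x != 0 &
           forall y, U y -> h y != 0 -> f y = g y / h y]).

(* The (reduced) locally closed subvariety with point set Z. *)
Definition fsub (K : Type) (X : fspace K) (Z : set (fcarrier X)) : fspace K :=
  @FSpace K (fcarrier X) Z
    (fun U => exists2 V, fopen X V & U = Z `&` V)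
    (fun U f => forall x, U x -> exists V F,
       [/\ fopen X V, V x, freg X V F & forall y, U y -> V y -> f y = F y]).

(* The quotient variety with quotient map p: the open sets are those with open
   preimage, and f is regular when f \o p is. *)
Definition fquot (K : Type) (X : fspace K) (T : Type) (p : fcarrier X -> T) :
    fspace K :=
  @FSpace K T (p @` fpts X)
    (fun U => U `<=` p @` fpts X /\ fopen X (fpts X `&` p @^-1` U))
    (fun U f => freg X (fpts X `&` p @^-1` U) (f \o p)).

(** * Subgroups of GL_n *)

(* Indices are 0-based: the letter i : 'I_n.-1 stands for the simple reflection
   with 1-based index i + 1, exchanging [slo i] and [shi i]. *)
Definition slo (n : nat) (i : 'I_n.-1) : 'I_n := widen_ord (leq_pred n) i.

Lemma shi_proof (n : nat) (i : 'I_n.-1) : (i.+1 < n)%N.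
Proof. by rewrite -ltn_predRL. Qed.

Definition shi (n : nat) (i : 'I_n.-1) : 'I_n := Ordinal (shi_proof i).

Definition GL (K : fieldType) (n : nat) : set 'M[K]_n := [set g | g \in unitmx].

Definition Bplus (K : fieldType) (n : nat) : set 'M[K]_n :=
  [set g | g \in unitmx /\ forall i j : 'I_n, (j < i)%N -> g i j = 0].

Definition Bminus (K : fieldType) (n : nat) : set 'M[K]_n :=
  [set g | g \in unitmx /\ forall i j : 'I_n, (i < j)%N -> g i j = 0].

Definition Uplus (K : fieldType) (n : nat) : set 'M[K]_n :=
  [set u | Bplus u /\ forall i, u i i = 1].

(* exp (t E) = 1 + t E for the square-zero matrix unit E. *)
Definition xroot (K : fieldType) (n : nat) (i : 'I_n.-1) (t : K) : 'M[K]_n :=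
  1%:M + t *: delta_mx (slo i) (shi i).

Definition yroot (K : fieldType) (n : nat) (i : 'I_n.-1) (t : K) : 'M[K]_n :=
  1%:M + t *: delta_mx (shi i) (slo i).

Definition sdot (K : fieldType) (n : nat) (i : 'I_n.-1) : 'M[K]_n :=
  xroot i 1 *m yroot i (-1) *m xroot i 1.

Definition worddot (K : fieldType) (n : nat) (r : seq 'I_n.-1) : 'M[K]_n :=
  \big[mulmx/1%:M]_(i <- r) sdot K i.

(* Permutations multiply left to right, so this is the inverse of the composite
   of the s_i taken from right to left; this affects neither reducedness nor
   length. *)
Definition wordperm (n : nat) (r : seq 'I_n.-1) : 'S_n :=
  (\prod_(i <- r) tperm (slo i) (shi i))%g.

Definition reduced_word (n : nat) (r : seq 'I_n.-1) : Prop :=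
  forall r' : seq 'I_n.-1, wordperm r' = wordperm r -> (size r <= size r')%N.

(* r is a reduced expression of the longest element of the subgroup generated
   by the simple reflections in I. *)
Definition longest_word (n : nat) (I : pred 'I_n.-1) (r : seq 'I_n.-1) : Prop :=
  [/\ all I r, reduced_word r &
      forall r' : seq 'I_n.-1, all I r' -> reduced_word r' ->
        (size r' <= size r)%N].

Definition lettersP (n k : nat) : pred 'I_n.-1 := fun i => i.+1 != (n - k)%N.

Definition is_subgroup (K : fieldType) (n : nat) (H : set 'M[K]_n) : Prop :=
  [/\ H `<=` @GL K n, H 1%:M,
      (forall g h, H g -> H h -> H (g *m h)) &
      (forall g, H g -> H (invmx g))].

Definition parabolic (K : fieldType) (n k : nat) : set 'M[K]_n :=
  [set g | forall H : set 'M[K]_n, is_subgroup H -> @Bplus K n `<=` H ->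
     (forall i, lettersP k i -> H (sdot K i)) -> H g].

Definition lcosetmx (K : fieldType) (n : nat) (H : set 'M[K]_n) (g : 'M[K]_n) :
  set 'M[K]_n := [set g *m h | h in H].

Definition rcosetmx (K : fieldType) (n : nat) (H : set 'M[K]_n) (g : 'M[K]_n) :
  set 'M[K]_n := [set h *m g | h in H].

Definition GLspace (K : fieldType) (n : nat) : fspace K :=
  @fsub K (mxspace K n n) (@GL K n).

(** * The mirror of the Grassmannian *)

(* The default value of [nth] is irrelevant when #|I| = #|J|; [enum] lists both
   sets in increasing order. *)
Definition minor (K : fieldType) (n : nat) (I J : {set 'I_n}) (g : 'M[K]_n) : K :=
  \det (\matrix_(a < #|I|, b < #|I|) g (enum_val a) (nth (enum_val a) (enum J) b)).

Definition lastrows (n k : nat) : {set 'I_n} := [set i : 'I_n | (n - k <= i)%N]%SET.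

(* Partitions are given by their sets of horizontal steps; the 1-based position
   i + 1 modulo n is the 0-based position i modulo n. *)
Definition Jmu (n k i : nat) : {set 'I_n} :=
  [set j : 'I_n | [exists c : 'I_k, ((i + c) %% n == j)%N]]%SET.

Definition Jmuhat (n k i : nat) : {set 'I_n} :=
  [set j : 'I_n | [exists c : 'I_k.-1, ((i + c) %% n == j)%N]
                  || ((i + k) %% n == j)%N]%SET.

Definition pmu (K : fieldType) (n k i : nat) (g : 'M[K]_n) : K :=
  minor (lastrows n k) (Jmu n k i) g.

Definition pmuhat (K : fieldType) (n k i : nat) (g : 'M[K]_n) : K :=
  minor (lastrows n k) (Jmuhat n k i) g.

Definition Xspace (K : fieldType) (n k : nat) : fspace K :=
  @fquot K (GLspace K n) _ (rcosetmx (@parabolic K n k)).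

Definition Xcirc (K : fieldType) (n k : nat) : set (set 'M[K]_n) :=
  [set x | exists g, [/\ GL g, x = rcosetmx (@parabolic K n k) g &
     forall i, (1 <= i <= n)%N -> pmu k i g != 0]].

Definition Xcirc_space (K : fieldType) (n k : nat) : fspace K :=
  @fsub K (Xspace K n k) (@Xcirc K n k).

Definition superpotential (K : fieldType) (n k : nat) (g : 'M[K]_n) (q : K) : K :=
  \sum_(1 <= i < n.+1) pmuhat k i g / pmu k i g * q ^+ (i == n - k)%N.

(** * The Richardson variety *)

Definition flag_space (K : fieldType) (n : nat) : fspace K :=
  @fquot K (GLspace K n) _ (lcosetmx (@Bminus K n)).

Definition Rich (K : fieldType) (n : nat) (wP w0 : 'M[K]_n) : set (set 'M[K]_n) :=
  [set x | exists g,
     [/\ x = lcosetmx (@Bminus K n) g,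
         (exists b b', [/\ Bplus b, Bminus b' & g = b *m wP *m b']) &
         (exists b b', [/\ Bminus b, Bminus b' & g = b *m w0 *m b'])]].

Definition Rich_space (K : fieldType) (n : nat) (wP w0 : 'M[K]_n) : fspace K :=
  @fsub K (flag_space K n) (Rich wP w0).

Definition Zset (K : fieldType) (n : nat) (wP w0 : 'M[K]_n) : set 'M[K]_n :=
  [set b | Bminus b /\ exists u1 u2,
     [/\ Uplus u1, Uplus u2 & b = u1 *m (wP *m invmx w0) *m u2]].

Definition Z_space (K : fieldType) (n : nat) (wP w0 : 'M[K]_n) : fspace K :=
  @fsub K (mxspace K n n) (Zset wP w0).

Definition piL (K : fieldType) (n k : nat) (b : 'M[K]_n) : set 'M[K]_n :=
  rcosetmx (@parabolic K n k) b.

Definition piR (K : fieldType) (n : nat) (w0 b : 'M[K]_n) : set 'M[K]_n :=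
  lcosetmx (@Bminus K n) (b *m w0).

(* The element of the torus fixed by W_P with alpha_(n-k) = d. *)
Definition torusP (K : fieldType) (n k : nat) (d : K) : 'M[K]_n :=
  diag_mx (\row_(i < n) if (i < n - k)%N then d else 1).

(** * Equivariant superpotentials *)

Definition expC (R : realType) (z : R[i]) : R[i] :=
  (expR (complex.Re z) * cos (complex.Im z))
    +i* (expR (complex.Re z) * sin (complex.Im z)).

Definition expT (R : realType) (n : nat) (H : 'M[R[i]]_n) : 'M[R[i]]_n :=
  diag_mx (\row_(i < n) expC (H i i)).

Definition lnT (R : realType) (n : nat) (t : 'M[R[i]]_n) : set 'M[R[i]]_n :=
  [set H | is_diag_mx H /\ expT H = t].

(* The torus factor of b in B_- = T U_-. *)
Definition torus_part (K : fieldType) (n : nat) (b : 'M[K]_n) : 'M[K]_n :=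
  diag_mx (\row_(i < n) b i i).

Definition epsv (K : fieldType) (n : nat) (i : 'I_n) : 'M[K]_n := delta_mx i i.

Definition simple_sum (K : fieldType) (n : nat) (u : 'M[K]_n) : K :=
  \sum_(i < n.-1) u (slo i) (shi i).

(* Multivalued maps are set-valued; the second component lies in the Lie algebra
   of diagonal matrices.  The vectors x i are the images in it of the
   equivariant parameters. *)
Definition Weq (R : realType) (n k : nat) (x : 'I_n -> 'M[R[i]]_n)
    (X : set 'M[R[i]]_n) (q : R[i]) : set (R[i] * 'M[R[i]]_n) :=
  [set v | exists (g : 'M[R[i]]_n) (lq : R[i]) (lp : 'I_n.-1 -> R[i]),
     [/\ X g /\ pmu k n g = 1,
         expC lq = q,
         forall i, expC (lp i) = pmu k i.+1 g &
         v = (superpotential k g q,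
              lq *: (\sum_(i < n | (i < n - k)%N) x i)
              + \sum_(i < n.-1) lp i *: (x (shi i) - x (slo i)))]].

Definition Feq (R : realType) (n k : nat) (wP w0 : 'M[R[i]]_n)
    (X : set 'M[R[i]]_n) (q : R[i]) : set (R[i] * 'M[R[i]]_n) :=
  [set v | exists b u1 u2 H : 'M[R[i]]_n,
     [/\ [/\ Bminus b, Uplus u1, Uplus u2 &
             b = u1 *m torusP n k q *m (wP *m invmx w0) *m u2],
         X = piR w0 b,
         lnT (torus_part b) H &
         v = (simple_sum u1 + simple_sum u2, H)]].

Definition mod_periods (R : realType) (n : nat) (A : set (R[i] * 'M[R[i]]_n)) :
    set (R[i] * 'M[R[i]]_n) :=
  [set v | exists w H, [/\ A w, lnT 1%:M H & v = (w.1, w.2 + H)]].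

(* Branches of an h-valued logarithm are only determined up to the kernel of
   exp : h -> T.  The plain sets of values can differ: the values of [Weq] at a
   point form a coset of a sublattice of index n - k in that kernel, those of
   [Feq] a coset of the whole kernel. *)
Definition mv_eq (R : realType) (n : nat) (A B : set (R[i] * 'M[R[i]]_n)) : Prop :=
  mod_periods A = mod_periods B.

(* Main.v *)
(* Put m = n - k.  The representatives of w_P and w_0 are signed permutation
   matrices whose signs count inversions, so M = w_P w_0^-1 is the block matrix with
   blocks (-1)^k and 1 on the antidiagonal.  For b in B_- with b = u_1 M u_2, row r of
   b agrees up to the diagonal with a vector of the row space of the last k rows that
   is fixed by its values on the k cyclically consecutive columns r+1, ..., r+k
   (it vanishes on all but the last, where it is a sign).  Cramer's rule then expresses
   the entries of b by Plucker coordinates with denominators p_(mu_(r+1)): this gives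
   the inverse of pi_L, the relation b_rr = p_(mu_r) / p_(mu_(r+1)), and the value of
   p_(hat mu_(r+1)) / p_(mu_(r+1)) as a sum of superdiagonal entries of u_1 and u_2.
   The reflection in the antidiagonal preserves the cell of such b and turns the first
   k columns into the last k rows, so the inverse of pi_R is obtained from that of
   pi_L. *)

Require Import Defs.
From mathcomp Require Import all_boot all_order all_algebra.
From mathcomp Require Import fingroup perm.
From mathcomp Require Import all_classical all_reals all_analysis.
From mathcomp Require Import complex.
From mathcomp Require Import zify ring.

Set Implicit Arguments.
Unset Strict Implicit.
Unset Printing Implicit Defensive.

Import Order.TTheory GRing.Theory Num.Theory.
Local Open Scope complex_scope.
Local Open Scope ring_scope.

(** * Regular maps between matrix varieties and quotients of GL_n *)

Section PolynomialFunctions.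
Variables (K : fieldType) (m n : nat).
Implicit Types f g : 'M[K]_(m, n) -> K.

(** The inverse of a map into a quotient is given on representatives: a matrix of fractions in the
    entries of g that is constant on cosets. Regularity on a quotient is tested on GL_n, so such a
    formula suffices and no local sections of the quotient maps are built. The parameter q enters by
    left translation. Since [torusP n k q] normalises U_+, the elements of B_- in U_+ torusP(q) M
    U_+ are exactly torusP(q) b with b in the cell for q = 1. The conjugation multiplies by q the
    one superdiagonal entry of u_1 that straddles the two blocks, which is the factor q of the
    superpotential; the first n - k diagonal entries of the translate are q b_rr, which is the term
    in ln q. This is why the potentials are compared along b -> torusP(q) b w_0 B_-. As for
    branches, both sides consist of logarithms of the diagonal of this translate, and modulo periods
    nothing else has to be matched. *)

Lemma mxpolyfun_ext f g : f =1 g -> mxpolyfun f -> mxpolyfun g.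
Proof. by move=> /funext ->. Qed.

Lemma mxpolyfun_sum (I : Type) (r : seq I) (P : pred I) (F : I -> 'M[K]_(m, n) -> K) :
  (forall i, mxpolyfun (F i)) -> mxpolyfun (fun A => \sum_(i <- r | P i) F i A).
Proof.
move=> hF; elim: r => [|i r ih].
  by apply: (@mxpolyfun_ext (fun=> 0)) => [A|]; [rewrite big_nil | exact: MxPolyConst].
case Pi: (P i).
  apply: (@mxpolyfun_ext (fun A => F i A + \sum_(i <- r | P i) F i A)) => [A|].
    by rewrite big_cons Pi.
  exact: MxPolyAdd.
by apply: mxpolyfun_ext ih => A; rewrite big_cons Pi.
Qed.

Lemma mxpolyfun_prod (I : Type) (r : seq I) (P : pred I) (F : I -> 'M[K]_(m, n) -> K) :
  (forall i, mxpolyfun (F i)) -> mxpolyfun (fun A => \prod_(i <- r | P i) F i A).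
Proof.
move=> hF; elim: r => [|i r ih].
  by apply: (@mxpolyfun_ext (fun=> 1)) => [A|]; [rewrite big_nil | exact: MxPolyConst].
case Pi: (P i).
  apply: (@mxpolyfun_ext (fun A => F i A * \prod_(i <- r | P i) F i A)) => [A|].
    by rewrite big_cons Pi.
  exact: MxPolyMul.
by apply: mxpolyfun_ext ih => A; rewrite big_cons Pi.
Qed.

Lemma mxpolyfun_det (d : nat) (F : 'M[K]_(m, n) -> 'M[K]_d) :
  (forall i j, mxpolyfun (fun A => F A i j)) -> mxpolyfun (fun A => \det (F A)).
Proof.
move=> hF; apply: mxpolyfun_sum => s; apply: MxPolyMul; first exact: MxPolyConst.
by apply: mxpolyfun_prod => i; exact: hF.
Qed.

Definition mxpolymap (p q : nat) (a : 'M[K]_(m, n) -> 'M[K]_(p, q)) : Prop :=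
  forall i j, mxpolyfun (fun A => a A i j).

Lemma mxpolyfun_comp (p q : nat) (a : 'M[K]_(m, n) -> 'M[K]_(p, q)) h :
  mxpolymap a -> mxpolyfun h -> mxpolyfun (h \o a).
Proof.
move=> ha; elim=> [c|i j|f g _ hf _ hg|f g _ hf _ hg].
- exact: MxPolyConst.
- exact: ha.
- exact: MxPolyAdd hf hg.
- exact: MxPolyMul hf hg.
Qed.

End PolynomialFunctions.

Lemma mxpolymap_id (K : fieldType) (m n : nat) : mxpolymap (@id 'M[K]_(m, n)).
Proof. by move=> i j; exact: MxPolyCoord. Qed.

Lemma mxpolymap_mulmx (K : fieldType) (m n p q : nat) (B : 'M[K]_(p, m)) (C : 'M[K]_(n, q)) :
  mxpolymap (fun A : 'M[K]_(m, n) => B *m A *m C).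
Proof.
move=> i j; apply: (@mxpolyfun_ext _ _ _
  (fun A => \sum_l (\sum_s B i s * A s l) * C l j)) => [A|].
  by rewrite !mxE; apply: eq_bigr => l _; rewrite mxE.
apply: mxpolyfun_sum => l; apply: MxPolyMul; last exact: MxPolyConst.
apply: mxpolyfun_sum => s; apply: MxPolyMul; first exact: MxPolyConst.
exact: MxPolyCoord.
Qed.

Section QuotientMorphisms.
Variables (K : fieldType) (n : nat) (T : Type) (p : 'M[K]_n -> T).
Variables (A : set T) (Z : set 'M[K]_n).

Let Q : fspace K := @fquot K (GLspace K n) T p.

Lemma fmorph_to_fquot (a : 'M[K]_n -> 'M[K]_n) :
    mxpolymap a -> (forall b, Z b -> @GL K n (a b)) -> (forall b, Z b -> A (p (a b))) ->
  @fmorph K (@fsub K (mxspace K n n) Z) (@fsub K Q A) (p \o a).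
Proof.
(* An open set of the quotient is known only through an ambient open set with the same trace on
   GL_n; on invertible matrices the two are interchangeable. *)
have openE V V0 b : (@GL K n `&` p @^-1` V = @GL K n `&` V0)%classic ->
    @GL K n b -> V (p b) <-> V0 b.
  by move=> /(congr1 (fun S => S b)); rewrite /setI /= propeqE; tauto.
move=> ha aGL aA; split=> [b /aA //|_ [V [_ [V0 V0o V0E]] ->]]; split.
  exists (a @^-1` V0)%classic.
    move=> b /V0o [h [hpol h0 hV]]; exists (h \o a); split=> //.
      exact: mxpolyfun_comp.
    by move=> y /hV.
  apply/seteqP; split=> b [Zb].
    by move=> [_ Vb]; split=> //; apply/(openE _ _ _ V0E) => //; exact: aGL.
  move=> /(openE _ _ _ V0E (aGL _ Zb)) Vb.
  by split=> //; split=> //; exact: aA.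
move=> f hf b [Zb [Ab Vb]].
have [V1 [F [[_ [V10 V10o V10E]] V1b Freg fF]]] := hf _ (conj Ab Vb).
have [V2 [F1 [V2o V2b F1reg FF1]]] := Freg _ (conj (aGL _ Zb) V1b).
exists (a @^-1` (V2 `&` V10))%classic, (F1 \o a); split.
- move=> y [/V2o [h [hpol h0 hV]] /V10o [h' [hpol' h0' hV']]].
  exists (fun y => h (a y) * h' (a y)); split.
  + by apply: MxPolyMul; [exact: (mxpolyfun_comp ha hpol) | exact: (mxpolyfun_comp ha hpol')].
  + by rewrite mulf_neq0.
  + by move=> z; rewrite mulf_eq0 negb_or => /andP[/hV ? /hV' ?].
- by split=> //; apply/(openE _ _ _ V10E) => //; exact: aGL.
- move=> y [/F1reg [g [h [gpol hpol h0 gh]]] _].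
  exists (g \o a), (h \o a); split=> //; try exact: mxpolyfun_comp.
  by move=> z [V2z _] hz; exact: gh.
move=> y [Zy [Ay Vy]] [V2y V10y].
have V1y : V1 (p (a y)) by apply/(openE _ _ _ V10E) => //; exact: aGL.
by rewrite /= fF // -FF1 //; split=> //; exact: aGL.
Qed.

Section RationalInverse.
Variables (num den : 'I_n -> 'I_n -> 'M[K]_n -> K).
Hypothesis numP : forall i j, mxpolyfun (num i j).
Hypothesis denP : forall i j, mxpolyfun (den i j).

Let dom (g : 'M[K]_n) : Prop := forall i j, den i j g != 0.
Let rat (g : 'M[K]_n) : 'M[K]_n := \matrix_(i, j) (num i j g / den i j g).

Lemma mxpolyfun_rat h : mxpolyfun h -> exists a d : 'M[K]_n -> K,
  [/\ mxpolyfun a, mxpolyfun d, forall g, dom g -> d g != 0 &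
      forall g, dom g -> h (rat g) = a g / d g].
Proof.
elim=> [c|i j|f1 f2 _ [a1 [d1 [a1P d1P d1n e1]]] _ [a2 [d2 [a2P d2P d2n e2]]]
       |f1 f2 _ [a1 [d1 [a1P d1P d1n e1]]] _ [a2 [d2 [a2P d2P d2n e2]]]].
- exists (fun=> c), (fun=> 1); split=> [||g _|g _]; rewrite ?oner_neq0 ?divr1 //;
  exact: MxPolyConst.
- by exists (num i j), (den i j); split=> // g _; rewrite mxE.
- exists (fun g => a1 g * d2 g + a2 g * d1 g), (fun g => d1 g * d2 g); split.
  + by apply: MxPolyAdd; apply: MxPolyMul.
  + exact: MxPolyMul.
  + by move=> g gd; rewrite mulf_neq0 ?d1n ?d2n.
  + by move=> g gd; rewrite e1 // e2 //; field; rewrite d1n ?d2n.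
- exists (fun g => a1 g * a2 g), (fun g => d1 g * d2 g); split.
  + exact: MxPolyMul.
  + exact: MxPolyMul.
  + by move=> g gd; rewrite mulf_neq0 ?d1n ?d2n.
  + by move=> g gd; rewrite e1 // e2 //; field; rewrite d1n ?d2n.
Qed.

(** One polynomial whose nonvanishing locus is [dom], as a basic open set requires. *)
Let domb (g : 'M[K]_n) : K := \prod_i \prod_j den i j g.

Let dombP : mxpolyfun domb.
Proof. by apply: mxpolyfun_prod => i; apply: mxpolyfun_prod. Qed.

Let domb_neq0 g : domb g != 0 <-> dom g.
Proof.
split=> [/prodf_neq0 h i j | h].
  by have /prodf_neq0 -> := h i isT.
by apply/prodf_neq0 => i _; apply/prodf_neq0.
Qed.

Variable psi : T -> 'M[K]_n.
Hypothesis psiE : forall g, @GL K n g -> dom g -> psi (p g) = rat g.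
Hypothesis dom_sat : forall g g', @GL K n g -> @GL K n g' -> p g = p g' -> dom g -> dom g'.
Hypothesis A_dom : forall y, A y -> exists g, [/\ @GL K n g, dom g & y = p g].
Hypothesis psiA : forall y, A y -> Z (psi y).

(** The preimage of [V] under [psi], extended from [A] to the image of [dom]. The extension is open
    in the quotient even if [A] is only locally closed, as a Richardson variety is. *)
Let opensub (V : set 'M[K]_n) : set T :=
  [set y | exists g, [/\ @GL K n g, dom g, y = p g & V (rat g)]].

Let open_dom (V : set 'M[K]_n) : set 'M[K]_n := [set g | dom g /\ V (rat g)].

Let open_domP V : fopen (mxspace K n n) V -> fopen (mxspace K n n) (open_dom V).
Proof.
move=> Vo g [gd /Vo [h [hP h0 hV]]].
have [a [d [aP dP dn ad]]] := mxpolyfun_rat hP.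
exists (fun y => domb y * a y); split.
- exact: MxPolyMul.
- rewrite mulf_neq0 //; first exact/domb_neq0.
  by apply: contraNneq h0 => a0; rewrite ad // a0 mul0r.
- move=> y; rewrite mulf_eq0 negb_or => /andP[/domb_neq0 yd ay]; split=> //.
  by apply: hV; rewrite ad // mulf_neq0 // invr_eq0 dn.
Qed.

Let opensubE V : (@GL K n `&` p @^-1` (opensub V) = @GL K n `&` open_dom V)%classic.
Proof.
apply/seteqP; split=> g [gG].
  move=> [g' [g'G g'd pE Vg']]; split=> //.
  have gd : dom g by apply: dom_sat g'd.
  by split=> //; rewrite -psiE // pE psiE.
by move=> [gd Vg]; split=> //; exists g.
Qed.

Let opensubP V : fopen (mxspace K n n) V -> fopen Q (opensub V).
Proof.
move=> Vo; split; first by move=> _ [g [gG gd -> _]]; exists g.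
by exists (open_dom V); [exact: open_domP | exact: opensubE].
Qed.

Let opensub_psi V y : A y -> opensub V y <-> V (psi y).
Proof.
move=> Ay; split=> [[g [gG gd -> Vg]]|]; first by rewrite psiE.
have [g [gG gd ->]] := A_dom Ay; rewrite psiE // => Vg.
by exists g.
Qed.

Lemma fmorph_of_fquot : @fmorph K (@fsub K Q A) (@fsub K (mxspace K n n) Z) psi.
Proof.
split=> // _ [V Vo ->]; split.
  exists (opensub V); first exact: opensubP.
  apply/seteqP; split=> y [Ay].
    by move=> [_ Vy]; split=> //; apply/opensub_psi.
  by move=> /(opensub_psi _ Ay) Vy; split=> //; split=> //; exact: psiA.
move=> f hf y [Ay [Zy Vy]].
have [V1 [F [V1o V1y Freg fF]]] := hf _ (conj Zy Vy).
exists (opensub V1), (F \o psi); split.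
- exact: opensubP.
- exact/opensub_psi.
- move=> g gV; have : (@GL K n `&` p @^-1` (opensub V1))%classic g by [].
  rewrite opensubE => -[gG gd1].
  exists (open_dom V1), (F \o rat); split=> //; first exact: open_domP.
    move=> x [xd /Freg [u [v [uP vP v0 uv]]]].
    have [a [d [aP dP dn ad]]] := mxpolyfun_rat uP.
    have [a' [d' [aP' dP' dn' ad']]] := mxpolyfun_rat vP.
    exists (fun y => a y * d' y), (fun y => d y * a' y).
    split; [exact: MxPolyMul | exact: MxPolyMul | |].
      rewrite mulf_neq0 ?dn //.
      by apply: contraNneq v0 => a0; rewrite ad' // a0 mul0r.
    move=> z [zd V1z]; rewrite mulf_eq0 negb_or => /andP[_ a'z].
    rewrite /= uv //; last by rewrite ad' // mulf_neq0 // invr_eq0 dn'.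
    by rewrite ad // ad' //; field; rewrite a'z dn' // dn.
  by move=> x [xG _] [xd Vx]; rewrite /= psiE.
by move=> z [Az [Zz Vz]] /(opensub_psi _ Az) V1z; rewrite /= fF.
Qed.

End RationalInverse.

(** Reduces an isomorphism onto a subvariety of a quotient to algebra: a fraction formula invariant
    along the fibres of [p] and undoing [a] on [Z]. *)
Lemma fiso_fquot (a : 'M[K]_n -> 'M[K]_n) (num den : 'I_n -> 'I_n -> 'M[K]_n -> K) :
    mxpolymap a -> (forall i j, mxpolyfun (num i j)) -> (forall i j, mxpolyfun (den i j)) ->
    let dom g := forall i j, den i j g != 0 in
    let rat g := \matrix_(i, j) (num i j g / den i j g) in
    (forall g g', @GL K n g -> @GL K n g' -> p g = p g' -> dom g ->
      dom g' /\ rat g = rat g') ->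
    (forall b, Z b -> [/\ @GL K n (a b), A (p (a b)), dom (a b) & rat (a b) = b]) ->
    (forall y, A y -> exists2 b, Z b & y = p (a b)) ->
  @fiso K (@fsub K (mxspace K n n) Z) (@fsub K Q A) (p \o a).
Proof.
move=> aP numP denP dom rat inv aZ aA.
(* The value of the formula at any admissible representative; invariance makes the choice harmless,
   and 0 is the default where there is none. *)
pose psi y := xget 0 [set M | exists g, [/\ @GL K n g, dom g, y = p g & M = rat g]]%classic.
have psiE g : @GL K n g -> dom g -> psi (p g) = rat g.
  move=> gG gd; rewrite /psi.
  case: xgetP => [_ -> [g' [g'G g'd pE ->]]|/(_ (rat g)) []]; last by exists g.
  by have [] := inv _ _ g'G gG (esym pE) g'd.
have psia b : Z b -> psi (p (a b)) = b by move=> /aZ [aG _ ad ar]; rewrite psiE.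
split; first by apply: fmorph_to_fquot => // b /aZ [].
exists psi; split=> //.
- apply: (@fmorph_of_fquot num den) => //.
  + by move=> g g' gG g'G pE gd; have [] := inv _ _ gG g'G pE gd.
  + by move=> y /aA [b /aZ [aG _ ad _] ->]; exists (a b).
  + by move=> y /aA [b Zb ->]; rewrite psia.
- by move=> y /aA [b Zb ->]; rewrite /= psia.
Qed.

End QuotientMorphisms.

(** * Root subgroups and representatives of simple reflections *)

Section RootSubgroups.
Variables (K : fieldType) (n : nat).
Implicit Types (l : 'I_n.-1) (A : 'M[K]_n).

Lemma slo_neq_shi l : (slo l == shi l) = false.
Proof. by apply/negbTE; rewrite -val_eqE /= neq_ltn ltnSn. Qed.

Lemma mul_xroot l t A i j :
  (xroot l t *m A) i j = A i j + (if i == slo l then t * A (shi l) j else 0).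
Proof.
rewrite mulmxDl mul1mx mxE -scalemxAl mxE; congr (_ + _).
rewrite mxE (bigD1 (shi l)) //= big1 ?addr0 => [|s /negbTE sn]; rewrite mxE ?sn ?andbF ?mul0r //.
by rewrite eqxx andbT; case: eqP => _; rewrite ?mul1r ?mul0r ?mulr0.
Qed.

Lemma mul_yroot l t A i j :
  (yroot l t *m A) i j = A i j + (if i == shi l then t * A (slo l) j else 0).
Proof.
rewrite mulmxDl mul1mx mxE -scalemxAl mxE; congr (_ + _).
rewrite mxE (bigD1 (slo l)) //= big1 ?addr0 => [|s /negbTE sn]; rewrite mxE ?sn ?andbF ?mul0r //.
by rewrite eqxx andbT; case: eqP => _; rewrite ?mul1r ?mul0r ?mulr0.
Qed.

Lemma mul_sdot l A i j : (sdot K l *m A) i j =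
  if i == slo l then A (shi l) j else if i == shi l then - A (slo l) j else A i j.
Proof.
rewrite /sdot -2!mulmxA; set B := _ *m A; set C := _ *m B.
have BE r : B r j = A r j + (if r == slo l then 1 * A (shi l) j else 0) by exact: mul_xroot.
have CE r : C r j = B r j + (if r == shi l then -1 * B (slo l) j else 0) by exact: mul_yroot.
rewrite mul_xroot !CE !BE !eqxx ?(eq_sym (shi l)) ?slo_neq_shi.
case: eqP => [->|_]; first by rewrite slo_neq_shi; ring.
by case: eqP => [->|_]; ring.
Qed.

Lemma sdotE l i j : sdot K l i j =
  if i == slo l then (shi l == j)%:R else if i == shi l then - (slo l == j)%:R
  else (i == j)%:R.
Proof. by rewrite -{1}[sdot K l]mulmx1 mul_sdot !mxE. Qed.

Lemma sdot_unit l : sdot K l \in unitmx.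
Proof.
rewrite /sdot !unitmx_mul.
have xy t : xroot l t *m xroot l (- t) = 1%:M :> 'M[K]_n.
  have E := mul_xroot l (- t) 1%:M; rewrite mulmx1 in E.
  apply/matrixP => i j; rewrite mul_xroot !E (eq_sym (shi l)) slo_neq_shi.
  by case: (i == slo l); rewrite mxE; ring.
have yx t : yroot l t *m yroot l (- t) = 1%:M :> 'M[K]_n.
  have E := mul_yroot l (- t) 1%:M; rewrite mulmx1 in E.
  apply/matrixP => i j; rewrite mul_yroot !E slo_neq_shi.
  by case: (i == shi l); rewrite mxE; ring.
have [ux _] := mulmx1_unit (xy 1); have [uy _] := mulmx1_unit (yx (-1)).
by rewrite ux uy.
Qed.

End RootSubgroups.

(** * Inversions, reduced words and the signs of longest elements *)

Section Inversions.
Variable n : nat.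
Implicit Types (s : 'S_n) (l : 'I_n.-1) (i j x y : 'I_n).

(** Inversions are charged to their later position because their parity there is the sign of row [i]
    in a reduced product of the [sdot]. *)
Definition inversions_at s i : nat := #|[set j : 'I_n | (j < i)%N && (s i < s j)%N]|.

Definition ninversions s : nat := \sum_i inversions_at s i.

Lemma ltn_tperm l x y :
    ~~ ((x == slo l) && (y == shi l)) -> ~~ ((x == shi l) && (y == slo l)) ->
  (tperm (slo l) (shi l) x < tperm (slo l) (shi l) y)%N = (x < y)%N.
Proof.
by case: tpermP => [->|->|/eqP + /eqP +]; case: tpermP => [->|->|/eqP + /eqP +];
   rewrite -?val_eqE /=; lia.
Qed.

(** Exchanging the values [slo l] and [shi l] changes the order of no other pair, so the only new
    inversion is at their two positions and is charged to the later one, that of [shi l]. *)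
Lemma inversions_at_ascent s l i : ((s^-1)%g (slo l) < (s^-1)%g (shi l))%N ->
  inversions_at (s * tperm (slo l) (shi l))%g i = (inversions_at s i + (s i == shi l))%N.
Proof.
set p1 := (s^-1)%g (slo l); set p2 := (s^-1)%g (shi l) => p12.
have sp1 : s p1 = slo l by rewrite permKV.
have sp2 : s p2 = shi l by rewrite permKV.
have E1 x : (s x == slo l) = (x == p1) by rewrite -sp1 (inj_eq perm_inj).
have E2 x : (s x == shi l) = (x == p2) by rewrite -sp2 (inj_eq perm_inj).
rewrite /inversions_at E2; case: (eqVneq i p2) => [->|ip2].
  rewrite addn1.
  have -> : [set j : 'I_n | (j < p2)%N && ((s * tperm (slo l) (shi l))%g p2
                                   < (s * tperm (slo l) (shi l))%g j)%N]%SET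
     = (p1 |: [set j : 'I_n | (j < p2)%N && (s p2 < s j)%N])%SET.
    apply/setP => j; rewrite !inE !permM.
    case: (eqVneq j p1) => [->|jp1] /=.
      by rewrite p12 sp1 sp2 tpermL tpermR /= ltnSn.
    case: ltnP => //= jp2; rewrite ltn_tperm // ?E1 ?E2 ?negb_and ?jp1 ?orbT //.
    by apply/orP; left; rewrite -val_eqE /=; lia.
  rewrite cardsU1 inE sp1 sp2.
  by have -> : (p1 < p2)%N && (shi l < slo l)%N = false by rewrite /=; lia.
rewrite addn0; congr #|pred_of_set _|; apply/setP => j; rewrite !inE !permM.
case: ltnP => //= ji; rewrite ltn_tperm // ?E1 ?E2 ?negb_and ?ip2 //.
by case: (eqVneq i p1) => //= ip1; rewrite -val_eqE /=; move: ip1 => /(congr1 val) /=; lia.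
Qed.

Lemma ninversions_ascent s l : ((s^-1)%g (slo l) < (s^-1)%g (shi l))%N ->
  ninversions (s * tperm (slo l) (shi l))%g = (ninversions s).+1.
Proof.
move=> asc; rewrite /ninversions (eq_bigr _ (fun i _ => inversions_at_ascent i asc)).
rewrite big_split /= [X in (_ + X)%N](_ : _ = 1%N) ?addn1 //.
rewrite (bigD1 ((s^-1)%g (shi l))) //= permKV eqxx big1 // => i.
by rewrite -(inj_eq (@perm_inj _ s)) permKV => /negbTE ->.
Qed.

Lemma ninversions_descent s l : ((s^-1)%g (shi l) < (s^-1)%g (slo l))%N ->
  ninversions s = (ninversions (s * tperm (slo l) (shi l))%g).+1.
Proof.
move=> desc; rewrite -(@ninversions_ascent _ l); last first.
  by rewrite invMg tpermV !permM tpermL tpermR.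
by rewrite -mulgA tperm2 mulg1.
Qed.

Lemma ninversions_tperm_le s l :
  (ninversions (s * tperm (slo l) (shi l))%g <= (ninversions s).+1)%N.
Proof.
have [/ninversions_ascent -> //|] := ltnP ((s^-1)%g (slo l)) ((s^-1)%g (shi l)).
rewrite leq_eqVlt => /orP[/eqP /val_inj /perm_inj /eqP|].
  by rewrite eq_sym slo_neq_shi.
by move=> /ninversions_descent ->; lia.
Qed.

Lemma ninversions1 : ninversions 1 = 0%N.
Proof.
rewrite /ninversions big1 // => i _; apply/eqP; rewrite cards_eq0; apply/eqP/setP => j.
by rewrite !inE !perm1; lia.
Qed.

Lemma wordperm_rcons r l :
  wordperm (rcons r l) = (wordperm r * tperm (slo l) (shi l))%g.
Proof. by rewrite /wordperm -cats1 big_cat /= big_seq1. Qed.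

Lemma ninversions_wordperm r : (ninversions (@wordperm n r) <= size r)%N.
Proof.
elim/last_ind: r => [|r l ih]; first by rewrite /wordperm big_nil ninversions1.
rewrite wordperm_rcons size_rcons; apply: leq_trans (ninversions_tperm_le _ _) _.
by rewrite ltnS.
Qed.

Lemma perm_ascending_eq1 s : (forall l, (s (slo l) < s (shi l))%N) -> s = 1%g.
Proof.
move=> asc; apply/permP => x; rewrite perm1; apply/val_inj/eqP; rewrite eqn_leq; apply/andP.
have step (a b : 'I_n) : (b = a.+1 :> nat) -> (s a < s b)%N.
  move=> ba; have la : (a < n.-1)%N by have := ltn_ord b; lia.
  by have := asc (Ordinal la); congr (s _ < s _)%N; apply/val_inj; rewrite /= ?ba.
split.
  suff H : forall d (x : 'I_n), (n - x.+1 = d)%N -> (s x <= x)%N by exact: H erefl.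
    elim=> [|d ih] {}x dE; first by have := ltn_ord (s x); have := ltn_ord x; lia.
    have xn : (x.+1 < n)%N by lia.
    have := ih (Ordinal xn) _; have := step x (Ordinal xn) erefl.
    by rewrite /=; lia.
suff H : forall d (x : 'I_n), x = d :> nat -> (x <= s x)%N by exact: H erefl.
  elim=> [|d ih] {}x dE; first by rewrite dE.
  have xn : (d < n)%N by have := ltn_ord x; lia.
  by have := ih (Ordinal xn) erefl; have := step (Ordinal xn) x; rewrite dE /=; lia.
Qed.

Lemma tperm_preserves m l x :
  l.+1 != m -> (tperm (slo l) (shi l) x < m)%N = (x < m)%N.
Proof. by move=> lm; case: tpermP => [->|->|_ _ //] /=; lia. Qed.

(** Bubble sort by removing descents. A descent between the values m - 1 and m cannot occur, since
    [s] preserves the positions below [m]. For [m] = 0 this covers the whole symmetric group. *)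
Lemma word_of_perm m s : (forall x, (s x < m)%N = (x < m)%N) ->
  exists r, [/\ all (fun l : 'I_n.-1 => l.+1 != m) r, wordperm r = s &
                size r = ninversions s].
Proof.
have [N] := ubnP (ninversions s); elim: N s => // N ih s sN hs.
have hsV x : ((s^-1)%g x < m)%N = (x < m)%N by rewrite -hs permKV.
have [l desc|none] := pickP (fun l => (s^-1)%g (shi l) < (s^-1)%g (slo l))%N; last first.
  have s1 : s = 1%g.
    apply: invg_inj; rewrite invg1; apply: perm_ascending_eq1 => l.
    have := none l; rewrite ltnNge => /negbFE; rewrite leq_eqVlt.
    by case/orP => // /eqP /val_inj /perm_inj /eqP; rewrite slo_neq_shi.
  by exists [::]; rewrite /wordperm big_nil s1 ninversions1.
have lm : l.+1 != m.
  have := hsV (shi l); have := hsV (slo l); rewrite /=; move: desc.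
  move: ((s^-1)%g (shi l)) ((s^-1)%g (slo l)) => a b; lia.
have [|x|r [rI rs rN]] := ih (s * tperm (slo l) (shi l))%g.
- by move: sN; rewrite (ninversions_descent desc); lia.
- by rewrite permM tperm_preserves.
exists (rcons r l); rewrite all_rcons lm rI wordperm_rcons rs size_rcons rN.
by rewrite -mulgA tperm2 mulg1 (ninversions_descent desc).
Qed.

Lemma reduced_word_size r : @reduced_word n r -> size r = ninversions (wordperm r).
Proof.
move=> red; have [//|r' [_ r'E sr']] := @word_of_perm 0 (wordperm r).
by apply/eqP; rewrite eqn_leq ninversions_wordperm -sr' red.
Qed.

Lemma wordperm_preserves m r x :
  all (fun l : 'I_n.-1 => l.+1 != m) r -> (wordperm r x < m)%N = (x < m)%N.
Proof.
elim/last_ind: r => [|r l ih]; first by rewrite /wordperm big_nil perm1.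
by rewrite all_rcons wordperm_rcons permM => /andP[lm rm]; rewrite tperm_preserves // ih.
Qed.

Lemma worddot_rcons (K : fieldType) r l : worddot K (rcons r l) = worddot K r *m sdot K l.
Proof.
rewrite /worddot; elim: r => [|x r ih] /=.
  by rewrite big_cons !big_nil mulmx1 mul1mx.
by rewrite !big_cons ih mulmxA.
Qed.

Definition signed_perm_mx (K : fieldType) s : 'M[K]_n :=
  \matrix_(i, j) ((-1) ^+ inversions_at s i * (s i == j)%:R).

(** Every letter of such a word is an ascent, and [sdot] negates exactly the row sent to [shi l],
    the one that gains an inversion. The hypothesis on the size, unlike a choice of word, passes
    directly to prefixes. *)
Lemma worddot_signed_perm_mx (K : fieldType) r :
  size r = ninversions (@wordperm n r) -> worddot K r = signed_perm_mx K (wordperm r).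
Proof.
elim/last_ind: r => [_|r l ih].
  rewrite /worddot /wordperm !big_nil; apply/matrixP => i j.
  rewrite !mxE perm1; suff -> : inversions_at 1 i = 0%N by rewrite mul1r.
  have := ninversions1; rewrite /ninversions => /eqP; rewrite sum_nat_eq0.
  by move=> /forallP /(_ i) /eqP.
rewrite size_rcons wordperm_rcons; set s := wordperm r => sz.
have sr := ninversions_wordperm r.
have asc : ((s^-1)%g (slo l) < (s^-1)%g (shi l))%N.
  rewrite ltnNge leq_eqVlt; apply/negP => /orP[/eqP /val_inj /perm_inj /eqP|].
    by rewrite eq_sym slo_neq_shi.
  by move=> /ninversions_descent; move: sr; rewrite -/s; lia.
have {}ih : worddot K r = signed_perm_mx K s.
  by apply: ih; move: sz; rewrite ninversions_ascent // -/s; lia.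
rewrite worddot_rcons ih.
apply/matrixP => i j; rewrite [RHS]mxE inversions_at_ascent // permM mxE.
rewrite (bigD1 (s i)) //= big1 ?addr0 => [|x /negbTE xi]; last first.
  by rewrite mxE eq_sym xi mulr0 mul0r.
rewrite mxE eqxx mulr1 sdotE exprD -mulrA; congr (_ * _).
case: tpermP => [->|->|/eqP/negbTE -> /eqP/negbTE ->]; rewrite ?eqxx ?slo_neq_shi ?mul1r //.
by rewrite eq_sym slo_neq_shi expr1 mulN1r.
Qed.

Section LongestElement.
Variables (m : nat) (hm : (m <= n)%N).

(** Reversal of [0, m) and of [m, n) separately, the longest element of the product of the two
    symmetric groups; [m] = 0 gives w_0. *)
Definition block_rev_fun (x : 'I_n) : 'I_n :=
  insubd x (if x < m then m.-1 - x else n.-1 - (x - m))%N.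

Lemma val_block_rev_fun x :
  block_rev_fun x = (if x < m then m.-1 - x else n.-1 - (x - m))%N :> nat.
Proof. by rewrite val_insubd /=; have := ltn_ord x; case: (ltnP x m); case: ifP; lia. Qed.

Lemma block_rev_funK : involutive block_rev_fun.
Proof.
move=> x; apply/val_inj; rewrite /= !val_block_rev_fun.
by have := ltn_ord x; case: (ltnP x m) => ? ?; case: ifP; lia.
Qed.

Definition block_rev : 'S_n := perm (inv_inj block_rev_funK).

(** The number of positions before [i] in its own block, hence the largest possible number of
    inversions charged to [i] by a permutation preserving the blocks. *)
Let bound i : nat := if (i < m)%N then i : nat else (i - m)%N.
Let low i : nat := if (i < m)%N then 0%N else m.

Let segment i : {set 'I_n} := [set j : 'I_n | (low i <= j < i)%N].

Let card_segment i : #|segment i| = bound i.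
Proof.
have -> : #|segment i| = (\sum_(low i <= j < i) 1)%N.
  rewrite big_geq_mkord (big_ord_widen_cond n (fun j : nat => (low i <= j)%N) (fun=> 1%N));
    last exact: ltnW.
  rewrite -sum1_card.
  by apply: eq_bigl => j; rewrite inE.
by rewrite sum_nat_const_nat muln1 /bound /low; case: ifP; rewrite ?subn0.
Qed.

Let inversions_sub s i : (forall x, (s x < m)%N = (x < m)%N) ->
  [set j : 'I_n | (j < i)%N && (s i < s j)%N] \subset segment i.
Proof.
move=> hs; apply/fintype.subsetP => j; rewrite !inE /low.
by have := hs i; have := hs j; case: ifP; lia.
Qed.

Let inversions_at_le s i : (forall x, (s x < m)%N = (x < m)%N) ->
  (inversions_at s i <= bound i)%N.
Proof. by move=> hs; rewrite -card_segment subset_leq_card // inversions_sub. Qed.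

Lemma inversions_at_block_rev i :
  inversions_at block_rev i = if (i < m)%N then i : nat else (i - m)%N.
Proof.
rewrite -/(bound i) -card_segment /inversions_at; congr #|pred_of_set _|.
apply/setP => j; rewrite !inE !permE !val_block_rev_fun /low.
by have := ltn_ord i; have := ltn_ord j; do 2!case: ifP; lia.
Qed.

Let block_rev_preserves x : (block_rev x < m)%N = (x < m)%N.
Proof. by rewrite permE val_block_rev_fun; have := ltn_ord x; case: ifP; lia. Qed.

Lemma longest_wordperm r :
  longest_word (fun l : 'I_n.-1 => l.+1 != m) r -> wordperm r = block_rev.
Proof.
move=> [rI rred rmax]; set s := wordperm r.
have hs x : (s x < m)%N = (x < m)%N by exact: wordperm_preserves.
have [r' [r'I r'E r'N]] := word_of_perm block_rev_preserves.
have r'red : reduced_word r'.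
  by move=> r'' E; rewrite r'N -r'E -E ninversions_wordperm.
have := rmax _ r'I r'red; rewrite r'N (reduced_word_size rred) -/s.
have Lif i : predT i -> (inversions_at s i <= bound i ?= iff (inversions_at s i == bound i))%N.
  by move=> _; apply: leqif_eq; exact: inversions_at_le.
rewrite /ninversions (eq_bigr _ (fun i _ => inversions_at_block_rev i)).
(* [block_rev] attains every local bound, so a longest word has at least as many inversions;
   termwise inequalities with such a sum are all equalities. *)
rewrite (geq_leqif (leqif_sum Lif)) => /forallP /= allE.
have dec (i j : 'I_n) : (j < i)%N -> (j < m)%N = (i < m)%N -> (s i < s j)%N.
  move=> ji jim; have /eqP : [set j : 'I_n | (j < i)%N && (s i < s j)%N] = segment i.
    apply/eqP; rewrite eqEcard inversions_sub // card_segment.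
    by rewrite -(eqP (allE i)) leqnn.
  move=> /eqP/setP/(_ j); rewrite !inE ji /=; case: (s i < s j)%N => //.
  by rewrite /low; move: jim; case: ifP; lia.
have : ninversions (s * block_rev)%g = 0%N.
  rewrite /ninversions big1 // => i _; apply/eqP; rewrite cards_eq0; apply/eqP/setP => j.
  rewrite !inE !permM !permE !val_block_rev_fun; apply/negP => /andP[ji].
  have := dec i j ji; have := hs i; have := hs j.
  by have := ltn_ord (s i); have := ltn_ord (s j); do 2!case: ifP; lia.
(* A permutation without inversions has a word of length 0, so it is 1. *)
have [|r1 [_ r1E <-]] := @word_of_perm 0 (s * block_rev)%g; first by [].
move=> /size0nil r10; move: r1E; rewrite r10 /wordperm big_nil => E.
have -> : s = (block_rev^-1)%g by apply: (mulIg block_rev); rewrite -E mulVg.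
apply: (mulIg block_rev); rewrite mulVg; apply/permP => x.
by rewrite permM !permE block_rev_funK.
Qed.

Lemma longest_worddot (K : fieldType) r :
    longest_word (fun l : 'I_n.-1 => l.+1 != m) r -> forall i j,
  worddot K r i j = (-1) ^+ (if i < m then i : nat else i - m)%N *
     ((if i < m then m.-1 - i else n.-1 - (i - m))%N == j)%:R.
Proof.
move=> long i j; have [_ red _] := long.
rewrite worddot_signed_perm_mx; last exact: reduced_word_size.
rewrite mxE longest_wordperm // inversions_at_block_rev; congr (_ * _%:R).
by rewrite -val_eqE permE /= val_block_rev_fun.
Qed.

End LongestElement.

End Inversions.

(** * Block triangular matrices, Borel subgroups and the parabolic P *)

Section BlockTriangular.
Variables (K : fieldType) (n : nat).
Implicit Types (m : nat) (A B : 'M[K]_n).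

Definition block_upper m A : Prop :=
  forall i j : 'I_n, (m <= i)%N -> (j < m)%N -> A i j = 0.

Lemma block_upper1 m : block_upper m 1%:M.
Proof. by move=> i j mi jm; rewrite mxE -val_eqE /=; case: eqP => //; lia. Qed.

Lemma block_upperM m A B : block_upper m A -> block_upper m B -> block_upper m (A *m B).
Proof.
move=> hA hB i j mi jm; rewrite mxE big1 // => s _.
by case: (ltnP s m) => sm; [rewrite hA ?mul0r | rewrite hB ?mulr0].
Qed.

(* The row vectors supported on the last n - m coordinates form a space that A
   maps into itself, hence onto itself. *)
Lemma block_upperV m A : A \in unitmx -> block_upper m A -> block_upper m (invmx A).
Proof.
move=> uA hA.
pose E : 'M[K]_n := \matrix_(i, j) ((i == j) && (m <= i)%N)%:R.
have mulE X i j : (E *m X) i j = if (m <= i)%N then X i j else 0.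
  rewrite mxE (bigD1 i) //= big1 ?addr0 => [|s /negbTE si]; rewrite mxE; last first.
    by rewrite eq_sym si mul0r.
  by rewrite eqxx; case: ifP; rewrite ?mul1r ?mul0r.
have mulrE X i j : (X *m E) i j = if (m <= j)%N then X i j else 0.
  rewrite mxE (bigD1 j) //= big1 ?addr0 => [|s /negbTE sj]; rewrite mxE; last first.
    by rewrite sj mulr0.
  by rewrite eqxx; case: ifP; rewrite ?mulr1 ?mulr0.
have EA : E *m A = (E *m A) *m E.
  apply/matrixP => i j; rewrite mulrE !mulE; case: ifP => // mi; case: ifP => // mj.
  by rewrite hA // ltnNge mj.
have sub : (E *m A <= E)%MS by rewrite EA submxMl.
have : (E <= E *m A)%MS.
  rewrite -(geq_leqif (mxrank_leqif_sup sub)) mxrankMfree //.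
  by rewrite row_free_unit.
move=> /submxP [X XE] i j mi jm.
have : E *m invmx A = X *m E by rewrite {1}XE -!mulmxA mulmxV // mulmx1.
move=> /matrixP /(_ i j); rewrite mulE mi mulrE leqNgt jm => -> //.
Qed.

(** Lets the closure properties of [Bplus] follow from those of each block condition. *)
Lemma upper_block A :
  (forall i j : 'I_n, (j < i)%N -> A i j = 0) <-> (forall m, block_upper m A).
Proof.
split=> [h m i j mi jm | h i j ji]; first by apply: h; lia.
exact: (h i).
Qed.

Lemma Bplus1 : @Bplus K n 1%:M.
Proof. by split; [exact: unitmx1 | apply/upper_block => m; exact: block_upper1]. Qed.

Lemma BplusM A B : Bplus A -> Bplus B -> Bplus (A *m B).
Proof.
move=> [uA /upper_block hA] [uB /upper_block hB]; split; first by rewrite unitmx_mul uA.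
by apply/upper_block => m; exact: block_upperM.
Qed.

Lemma BplusV A : Bplus A -> Bplus (invmx A).
Proof.
move=> [uA /upper_block hA]; split; first by rewrite unitmx_inv.
by apply/upper_block => m; exact: block_upperV.
Qed.

Lemma Bplus_diagM A B i : Bplus A -> Bplus B -> (A *m B) i i = A i i * B i i.
Proof.
move=> [_ hA] [_ hB]; rewrite mxE (bigD1 i) //= big1 ?addr0 // => s si.
case: (ltngtP s i) => [lt|lt|/val_inj E]; first by rewrite hA ?mul0r.
  by rewrite hB ?mulr0.
by rewrite E eqxx in si.
Qed.

Lemma Bplus_diag_neq0 A i : Bplus A -> A i i != 0.
Proof.
move=> hA; have := Bplus_diagM i hA (BplusV hA); rewrite mulmxV; last by case: hA.
by rewrite mxE eqxx => E; apply/eqP => A0; move/eqP: E; rewrite A0 mul0r oner_eq0.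
Qed.

Lemma UplusV A : Uplus A -> Uplus (invmx A).
Proof.
move=> [hA A1]; split; first exact: BplusV.
move=> i; have := Bplus_diagM i hA (BplusV hA); rewrite mulmxV; last by case: hA.
by rewrite A1 mul1r mxE eqxx => <-.
Qed.

Lemma Bminus_tr A : Bminus A <-> Bplus A^T.
Proof.
by split=> -[uA hA]; (split; first by rewrite ?unitmx_tr // -unitmx_tr);
   move=> i j ij; [rewrite mxE hA | rewrite -(hA j i ij) mxE].
Qed.

Lemma BminusM A B : Bminus A -> Bminus B -> Bminus (A *m B).
Proof. by rewrite !Bminus_tr trmx_mul => hA hB; exact: BplusM. Qed.

Lemma BminusV A : Bminus A -> Bminus (invmx A).
Proof. by rewrite !Bminus_tr trmx_inv => hA; exact: BplusV. Qed.

Lemma Bminus1 : @Bminus K n 1%:M.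
Proof. by rewrite Bminus_tr trmx1; exact: Bplus1. Qed.

Lemma upper_unit A :
  (forall i j : 'I_n, (j < i)%N -> A i j = 0) -> (forall i, A i i != 0) -> A \in unitmx.
Proof.
move=> hA dA; rewrite unitmxE -det_tr det_trig; last first.
  by apply/is_trig_mxP => i j ij; rewrite mxE hA.
by rewrite unitfE; apply/prodf_neq0 => i _; rewrite mxE.
Qed.

Lemma sdot_block_upper m (l : 'I_n.-1) : l.+1 != m -> block_upper m (sdot K l).
Proof.
move=> lm i j mi jm; rewrite sdotE -!val_eqE /=.
by do ![case: eqP => ?]; rewrite ?oppr0 //; lia.
Qed.

Lemma xroot_Bplus (l : 'I_n.-1) t : @Bplus K n (xroot l t).
Proof.
have E i j : xroot l t i j = (i == j)%:R + (if i == slo l then t * (shi l == j)%:R else 0).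
  by rewrite -[xroot l t]mulmx1 mul_xroot !mxE.
have up (i j : 'I_n) : (j < i)%N -> xroot l t i j = 0.
  by rewrite E -!val_eqE /=; do ![case: eqP => ?]; rewrite ?mulr0 ?addr0 //; lia.
split=> //; apply: upper_unit => // i.
rewrite E eqxx; have [->|_] := eqVneq i (slo l); last by rewrite addr0 oner_neq0.
by rewrite (eq_sym (shi l)) slo_neq_shi mulr0 addr0 oner_neq0.
Qed.

(* Gaussian elimination with adjacent rows only: a nonzero entry y below x is
   removed by first clearing x with a root subgroup and then exchanging the two
   rows by sdot.  The exchange across rows m - 1 and m is never needed. *)
Lemma block_upper_generated m (H : set 'M[K]_n) :
    is_subgroup H -> (forall A, Bplus A -> H A) ->
    (forall l : 'I_n.-1, l.+1 != m -> H (sdot K l)) ->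
  forall A, A \in unitmx -> block_upper m A -> H A.
Proof.
move=> [_ _ HM HV] HB Hs.
suff main d j : (n - j <= d)%N -> forall A, A \in unitmx -> block_upper m A ->
    (forall r c : 'I_n, (c < j)%N -> (c < r)%N -> A r c = 0) -> H A.
  by move=> A uA bA; apply: (main n 0%N) => //; lia.
elim: d j => [|d ihd] j jd A uA bA clear.
  by apply: HB; split=> // r c cr; apply: clear => //; have := ltn_ord c; lia.
(* Columns before [j] are already clear; column [j] is cleared upwards, [i] being the last row that
   may still be nonzero. *)
suff inner e i : (i <= j + e)%N -> forall A, A \in unitmx -> block_upper m A ->
    (forall r c : 'I_n, (c < j)%N -> (c < r)%N -> A r c = 0) ->
    (forall r c : 'I_n, c = j :> nat -> (i < r)%N -> A r c = 0) -> H A.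
  by apply: (inner n n) => // [|r c _]; [lia | have := ltn_ord r; lia].
elim: e i {A uA bA clear} => [|e ihe] i ie A uA bA clear cleari.
  apply: (ihd j.+1) => //; first by lia.
  move=> r c; rewrite ltnS leq_eqVlt => /orP[/eqP cj cr|]; last exact: clear.
  by apply: cleari => //; lia.
have [le|gt] := leqP i (j + e); first exact: (ihe i).
have iE : i = (j + e).+1 by lia.
have [ni|lt_in] := leqP n i.
  apply: (ihe (j + e)%N) => // r c cj; have := ltn_ord r; lia.
have ln : (j + e < n.-1)%N by lia.
pose l : 'I_n.-1 := Ordinal ln.
have lt_jn : (j < n)%N by lia.
pose cj : 'I_n := Ordinal lt_jn.
have [b0|bN0] := eqVneq (A (shi l) cj) 0.
  apply: (ihe (j + e)%N) => // r c cE.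
  have -> : c = cj by apply/val_inj.
  rewrite leq_eqVlt => /orP[/eqP rE|lt]; last by apply: cleari => //; lia.
  by rewrite -[RHS]b0; congr (A _ _); apply/val_inj; rewrite /= -rE.
have lm : l.+1 != m.
  apply: contraNneq bN0 => lm; rewrite bA //=; first by rewrite -lm.
  by rewrite -lm /=; lia.
(* This [t] makes row [slo l] vanish in column [j], so that the exchange puts a zero below. *)
pose t := - (A (slo l) cj / A (shi l) cj).
pose g : 'M[K]_n := sdot K l *m xroot l t.
have ug : g \in unitmx by rewrite unitmx_mul sdot_unit; case: (xroot_Bplus l t).
have Hg : H g by apply: HM; [exact: Hs | apply: HB; exact: xroot_Bplus].
have gE r c : (g *m A) r c = if r == slo l then A (shi l) c
    else if r == shi l then - (A (slo l) c + t * A (shi l) c) else A r c.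
  rewrite -mulmxA mul_sdot !mul_xroot eqxx (eq_sym (shi l)) slo_neq_shi addr0.
  by case: (r == slo l); rewrite ?addr0.
rewrite -[A](mulKmx ug); apply: HM; first exact: HV.
apply: (ihe (j + e)%N) => //.
- by rewrite unitmx_mul ug.
- apply: block_upperM => //; apply: block_upperM; first exact: sdot_block_upper.
  by case: (xroot_Bplus l t) => _ /upper_block.
- move=> r c cj' cr; rewrite gE.
  have z (r' : 'I_n) : (j <= r')%N -> A r' c = 0 by move=> jr; apply: clear => //; lia.
  rewrite (z (shi l)) /=; last by lia.
  by rewrite (z (slo l)) /= ?leq_addr // mulr0 addr0 oppr0 clear // !if_same.
- move=> r c cE lt; have -> : c = cj by apply/val_inj.
  rewrite gE -!val_eqE /=; case: eqP => [|_]; first by lia.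
  case: eqP => [_|ne]; last by apply: cleari => //; lia.
  by rewrite /t mulNr mulfVK // subrr oppr0.
Qed.

(** The block group is one of the subgroups in the intersection defining [parabolic], and
    elimination shows that each of them contains it. *)
Lemma parabolicP (k : nat) A :
  parabolic k A <-> A \in unitmx /\ block_upper (n - k) A.
Proof.
split=> [|[uA bA] H sH HB Hs]; last exact: (block_upper_generated sH HB Hs).
move=> /(_ [set B | B \in unitmx /\ block_upper (n - k) B]%classic); apply.
- split=> [B [] //|||].
  + by split; [exact: unitmx1 | exact: block_upper1].
  + move=> B C [uB bB] [uC bC]; split; first by rewrite unitmx_mul uB.
    exact: block_upperM.
  + by move=> B [uB bB]; split; [rewrite unitmx_inv | exact: block_upperV].
- by move=> B [uB /upper_block bB].
- by move=> l lk; split; [exact: sdot_unit | exact: sdot_block_upper].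
Qed.

End BlockTriangular.

(** * Cramer's rule and sorted enumerations *)

Section Determinants.
Variable K : fieldType.

Lemma opp_signr_pred (k : nat) : (0 < k)%N -> - (-1) ^+ k = (-1) ^+ k.-1 :> K.
Proof. by case: k => // k _; rewrite exprS mulN1r opprK. Qed.

Lemma det_cast_ord (p q : nat) (E : p = q) (A : 'M[K]_p) (B : 'M[K]_q) :
  (forall i j, A i j = B (cast_ord E i) (cast_ord E j)) -> \det A = \det B.
Proof.
case: q / E B => B AB; congr (\det _); apply/matrixP => i j.
by rewrite AB !cast_ord_id.
Qed.

(** The moved column is first in [A] and last in [B]; expansion along it gives the same
    complementary minors, with signs differing by k - 1 exchanges. *)
Lemma det_rotate_cols (k : nat) (A B : 'M[K]_k) : (0 < k)%N ->
    (forall i (a b : 'I_k), a = b.+1 :> nat -> A i a = B i b) ->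
    (forall i (a b : 'I_k), a = 0%N :> nat -> b = k.-1 :> nat -> A i a = B i b) ->
  \det A = (-1) ^+ k.-1 * \det B.
Proof.
case: k A B => // k A B _ hS h0.
rewrite (expand_det_col A ord0) (expand_det_col B ord_max) mulr_sumr.
apply: eq_bigr => i _; rewrite (h0 _ ord0 ord_max) // /cofactor [RHS]mulrCA; congr (_ * _).
have -> : col' ord0 A = col' ord_max B.
  by apply/matrixP => r c; rewrite !mxE; apply: hS; rewrite lift0 lift_max.
by rewrite mulrA -exprD addn0 addnCA exprD addnn -mul2n exprM sqrrN !expr1n mulr1.
Qed.

Definition replace_col (k : nat) (N : 'M[K]_k) (t : 'I_k) (c : 'I_k -> K) : 'M[K]_k :=
  \matrix_(i, j) if j == t then c i else N i j.

Lemma det_replace_col (k : nat) (N : 'M[K]_k) t c :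
  \det (replace_col N t c) = \sum_s (\adj N) t s * c s.
Proof.
rewrite (expand_det_col _ t); apply: eq_bigr => s _; rewrite !mxE eqxx mulrC.
congr (_ * _ * _); congr (\det _); apply/matrixP => i j; rewrite !mxE.
by rewrite eq_sym (negbTE (neq_lift _ _)).
Qed.

(** Multiplying z N = beta e_t by the adjugate gives z det N = beta times row [t] of adj N, and
    pairing that row with [c] is expansion along the replaced column. *)
Lemma cramer_row (k : nat) (z : 'rV[K]_k) (N : 'M[K]_k) t beta c :
    (forall b, (z *m N) 0 b = beta *+ (b == t)) ->
  (\sum_s z 0 s * c s) * \det N = beta * \det (replace_col N t c).
Proof.
move=> zN; rewrite det_replace_col [RHS]mulr_sumr [LHS]mulr_suml; apply: eq_bigr => s _.
have : (z *m (N *m \adj N)) 0 s = beta * (\adj N) t s.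
  rewrite mulmxA mxE (bigD1 t) //= big1 ?addr0; first by rewrite zN eqxx.
  by move=> b /negbTE bt; rewrite zN bt mul0r.
rewrite mul_mx_adj mul_mx_scalar mxE mulrA => <-.
by rewrite mulrC mulrA.
Qed.

End Determinants.

Section SortedEnumeration.
Variable n : nat.

Let ltI : rel 'I_n := fun i j => (i < j)%N.

Let enum_ltI_sorted : sorted ltI (enum 'I_n).
Proof. by rewrite -(sorted_map (f := val) (e' := ltn)) val_enum_ord iota_ltn_sorted. Qed.

Lemma enum_increasing_image (k : nat) (J : {set 'I_n}) (f : 'I_k -> 'I_n) :
    (forall a b : 'I_k, (a < b)%N -> (f a < f b)%N) ->
    (forall j, (j \in J) = [exists b, f b == j]) ->
  enum J = [seq f b | b <- enum 'I_k].
Proof.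
move=> finc fJ; apply: (@irr_sorted_eq _ ltI).
- by move=> x y z; exact: ltn_trans.
- by move=> x; exact: ltnn.
- by rewrite {1}/enum_mem -enumT; apply: sorted_filter => //; move=> x y z; exact: ltn_trans.
- rewrite sorted_map; apply: (@sub_sorted _ (fun a b : 'I_k => (a < b)%N)).
    by move=> a b; exact: finc.
  by rewrite -(sorted_map (f := val) (e' := ltn)) val_enum_ord iota_ltn_sorted.
move=> j; rewrite mem_enum fJ; apply/existsP/mapP => [[b /eqP <-]|[b _ ->]].
  by exists b; rewrite ?mem_enum.
by exists b.
Qed.

End SortedEnumeration.

Lemma modn_lt2 (n x : nat) : (x < n + n)%N -> (x %% n)%N = if (x < n)%N then x else (x - n)%N.
Proof.
move=> x2; case: ltnP => [/modn_small //|nx].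
by rewrite -{1}(subnK nx) modnDr modn_small //; lia.
Qed.

(** * Cyclic column sets and Plücker minors *)

Section Pivots.
Variables (n k : nat) (hk : (1 <= k <= n.-1)%N).
Implicit Types (r j : 'I_n) (b : 'I_k).

Lemma lastrow_proof b : (n - k + b < n)%N.
Proof. by have := ltn_ord b; lia. Qed.

Definition lastrow b : 'I_n := Ordinal (lastrow_proof b).

(* The index of the unique nonzero entry in row [r] of [wP w0^-1]. *)
Definition pivot r : 'I_n := insubd r (if r < n - k then r + k else r - (n - k))%N.

Lemma val_pivot r : pivot r = (if r < n - k then r + k else r - (n - k))%N :> nat.
Proof. by rewrite val_insubd /=; have := ltn_ord r; case: ifP; case: ifP; lia. Qed.

Lemma pivot_inj : injective pivot.
Proof.
move=> r s /(congr1 val); rewrite /= !val_pivot => E; apply/val_inj => /=.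
by move: E; have := ltn_ord r; have := ltn_ord s; do !case: ifP; lia.
Qed.

(* The columns of J_(mu_i) in increasing order. *)
Definition mucol (i : nat) (b : nat) : nat :=
  if (i <= n - k)%N then (i + b)%N else if (b < i - (n - k))%N then b else (n - k + b)%N.

(* The position of [pivot r] among the columns [mucol r.+1]. *)
Definition pivot_pos r : nat := if (r < n - k)%N then k.-1 else (r - (n - k))%N.

Lemma pivot_pos_lt r : (pivot_pos r < k)%N.
Proof. by rewrite /pivot_pos; have := ltn_ord r; case: ifP; lia. Qed.

Definition pivot_ord r : 'I_k := Ordinal (pivot_pos_lt r).

(* J_(mu_(r+1)) with [pivot r] replaced by [j]. *)
Definition mucol_rep r j (b : 'I_k) : 'I_n :=
  if b == pivot_ord r then j else insubd r (mucol r.+1 b).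

Lemma val_mucol_rep r j b :
  mucol_rep r j b = (if b == pivot_pos r :> nat then j : nat else mucol r.+1 b) :> nat.
Proof.
rewrite /mucol_rep -val_eqE /=; case: ifP => // _; rewrite val_insubd /mucol.
by have := ltn_ord r; have := ltn_ord b; rewrite /=; do !case: ifP; lia.
Qed.

Lemma mucol_rep_pivot r b : mucol_rep r (pivot r) b = mucol r.+1 b :> nat.
Proof.
rewrite val_mucol_rep val_pivot; case: eqP => //; rewrite /pivot_pos /mucol.
by have := ltn_ord r; do !case: ifP; lia.
Qed.

End Pivots.

Section Minors.
Variables (K : fieldType) (n k : nat) (hk : (1 <= k <= n.-1)%N).
Implicit Types (g : 'M[K]_n) (r j : 'I_n) (b : 'I_k).
Local Notation lastrow := (lastrow hk).
Local Notation mucol_rep := (mucol_rep hk).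

Lemma in_lastrows j : (j \in lastrows n k) = [exists b, lastrow b == j].
Proof.
rewrite inE; apply/idP/existsP => [nkj|[b /eqP <-]]; last exact: leq_addr.
have bk : (j - (n - k) < k)%N by have := ltn_ord j; lia.
by exists (Ordinal bk); rewrite -val_eqE /= subnKC.
Qed.

Lemma minor_lastrows (J : {set 'I_n}) (f : 'I_k -> 'I_n) g :
    (forall a b : 'I_k, (a < b)%N -> (f a < f b)%N) ->
    (forall j, (j \in J) = [exists b, f b == j]) ->
  minor (lastrows n k) J g = \det (\matrix_(a < k, b < k) g (lastrow a) (f b)).
Proof.
move=> finc fJ; rewrite /minor.
have linc (a b : 'I_k) : (a < b)%N -> (lastrow a < lastrow b)%N by rewrite /=; lia.
have EI := enum_increasing_image linc in_lastrows.
have EJ := enum_increasing_image finc fJ.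
have E : #|lastrows n k| = k by rewrite cardE EI size_map size_enum_ord.
apply: (det_cast_ord (E := E)) => a b; rewrite !mxE EJ.
rewrite (nth_map (cast_ord E b)) ?size_enum_ord -?[X in (_ < X)%N]E //.
rewrite (nth_ord_enum _ (cast_ord E b)) (enum_val_nth (lastrow (cast_ord E a))) EI.
rewrite (nth_map (cast_ord E a)) ?size_enum_ord -?[X in (_ < X)%N]E //.
by rewrite (nth_ord_enum _ (cast_ord E a)).
Qed.

(** The column [j] stays unsorted in the slot of [pivot r], which keeps the minor linear in that
    column; signs appear only in the comparison with sorted minors. *)
Definition pminor r j g : K := \det (\matrix_(a < k, b < k) g (lastrow a) (mucol_rep r j b)).

Lemma pmu_det (i : nat) (f : 'I_k -> 'I_n) g :
    (i <= n)%N -> (forall b, f b = mucol n k i b :> nat) ->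
  pmu k i g = \det (\matrix_(a < k, b < k) g (lastrow a) (f b)).
Proof.
move=> le_in fE; apply: minor_lastrows => [a b ab|j].
  by rewrite !fE /mucol; have := ltn_ord b; do !case: ifP; lia.
rewrite inE; apply/existsP/existsP => [[c]|[b]].
  rewrite modn_lt2; last by have := ltn_ord c; lia.
  move=> /eqP cj.
  (* The rank of column i + c mod n: in a cyclic interval that wraps around, the wrapped columns
     come first. *)
  pose x := if (i <= n - k)%N then c : nat else if (i + c < n)%N then (i + c - (n - k))%N
            else (i + c - n)%N.
  have xk : (x < k)%N by rewrite /x; have := ltn_ord c; do !case: ifP; lia.
  exists (Ordinal xk); rewrite -val_eqE /= fE -cj /mucol /= /x.
  by have := ltn_ord c; do !case: ifP; lia.
rewrite -val_eqE /= fE /mucol => /eqP bj.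
pose x := if (i <= n - k)%N then b : nat else if (b < i - (n - k))%N then (n + b - i)%N
          else (n - k + b - i)%N.
have xk : (x < k)%N by rewrite /x; have := ltn_ord b; do !case: ifP; lia.
exists (Ordinal xk); rewrite modn_lt2 /=; last by have := ltn_ord b; lia.
by rewrite -bj /x; have := ltn_ord b; do !case: ifP; lia.
Qed.

(** Closes the cycle, so that the ratios p_(mu_r) / p_(mu_(r+1)) may start at r = 0. *)
Lemma pmu0 g : pmu k 0 g = pmu k n g.
Proof.
rewrite /pmu; congr (minor _ _ g); apply/setP => j; rewrite !inE.
by apply: eq_existsb => c; rewrite add0n modnDl.
Qed.

Lemma pmu_pminor r g : pmu k r.+1 g = pminor r (pivot k r) g.
Proof. by apply: pmu_det => // b; rewrite mucol_rep_pivot. Qed.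

(** In the top rows this is (-1)^(k-1), at once the sign of a rotation of k columns and minus the
    sign of the pivot of M. *)
Definition row_sign r : K := if (r < n - k)%N then - (-1) ^+ k else 1.

Lemma row_sign_neq0 r : row_sign r != 0.
Proof. by rewrite /row_sign; case: ifP; rewrite ?oppr_eq0 ?signr_eq0 ?oner_neq0. Qed.

(** Passing from mu_(r+1) to mu_r drops [pivot r] and adds [r]. In a top row the new column is the
    smallest but occupies the last slot, whence the rotation; otherwise the slot is already in
    order. *)
Lemma pmu_pminor_diag r g : pmu k r g = row_sign r * pminor r r g.
Proof.
have lt_rn := ltn_ord r; rewrite /row_sign; case: ltnP => rm.
  pose f b : 'I_n := insubd r (r + b)%N.
  have fE b : f b = (r + b)%N :> nat.
    by rewrite val_insubd /=; have := ltn_ord b; case: ifP; lia.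
  rewrite (pmu_det (f := f)); [|by lia|by move=> b; rewrite fE /mucol (ltnW rm)].
  rewrite opp_signr_pred; last by lia.
  apply: det_rotate_cols; first by lia.
    move=> a x y xy; rewrite !mxE; congr (g _ _); apply/val_inj; rewrite /= fE val_mucol_rep.
    rewrite /pivot_pos /mucol rm; have := ltn_ord x; have := ltn_ord y.
    by do !case: ifP; lia.
  move=> a x y x0 yk; rewrite !mxE; congr (g _ _); apply/val_inj; rewrite /= fE val_mucol_rep.
  by rewrite /pivot_pos rm yk eqxx x0 addn0.
rewrite mul1r; apply: pmu_det; first by lia.
move=> b; rewrite val_mucol_rep /pivot_pos /mucol.
by have := ltn_ord b; do !case: ifP; lia.
Qed.

Lemma pmuhat_pminor r j g : r.+1 != (n - k)%N -> j = (pivot k r).+1 :> nat ->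
  pmuhat k r.+1 g = pminor r j g.
Proof.
move=> rm; rewrite val_pivot // => jE; have lt_rn := ltn_ord r; have lt_jn := ltn_ord j.
apply: minor_lastrows => [a b ab|x].
  rewrite !val_mucol_rep jE /pivot_pos /mucol; have := ltn_ord b.
  by do !case: ifP; lia.
rewrite inE; apply/orP/existsP => [[/existsP [c]|]|[b]].
- have lt_c := ltn_ord c; rewrite modn_lt2; last by lia.
  move=> /eqP cx.
  pose y := if (r < n - k)%N then c : nat else if (r.+1 + c < n)%N then (r.+1 + c - (n - k))%N
            else (r.+1 + c - n)%N.
  have yk : (y < k)%N by rewrite /y; do !case: ifP; lia.
  exists (Ordinal yk); rewrite -val_eqE /= val_mucol_rep jE -cx /pivot_pos /mucol /= /y.
  by do !case: ifP; lia.
- rewrite modn_lt2; last by lia.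
  move=> /eqP cx; exists (pivot_ord hk r); rewrite -val_eqE /= val_mucol_rep eqxx jE -cx.
  by do !case: ifP; lia.
have lt_b := ltn_ord b.
rewrite -val_eqE /= val_mucol_rep jE /pivot_pos /mucol => /eqP bx.
have [bp|bp] := eqVneq (b : nat) (pivot_pos k r).
  right; rewrite modn_lt2; last by lia.
  by rewrite -bx; move: bp; rewrite /pivot_pos; do !case: ifP; lia.
left; move: bp; rewrite /pivot_pos => bp.
pose y := if (r < n - k)%N then b : nat else if (b < r - (n - k))%N then (n + b - r.+1)%N
          else (n - k + b - r.+1)%N.
have yk : (y < k.-1)%N by rewrite /y; move: bp; do !case: ifP; lia.
apply/existsP; exists (Ordinal yk); rewrite modn_lt2 /=; last by lia.
by rewrite -bx /y; move: bp; do !case: ifP; lia.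
Qed.

(** Here [pivot r] is the last column and its cyclic successor is column 0, which sorts first but
    sits in the last slot. *)
Lemma pmuhat_pminor_corner r j g : r.+1 = (n - k)%N -> j = 0%N :> nat ->
  pmuhat k r.+1 g = row_sign r * pminor r j g.
Proof.
move=> rm j0; have lt_rn := ltn_ord r.
pose f b : 'I_n := if (b == 0%N :> nat) then j else insubd r (r + b)%N.
have fE b : f b = (if (b == 0%N :> nat) then 0%N else (r + b)%N) :> nat.
  by rewrite /f; case: ifP => //; rewrite val_insubd /=; have := ltn_ord b; case: ifP; lia.
have -> : pmuhat k r.+1 g = \det (\matrix_(a < k, b < k) g (lastrow a) (f b)).
  apply: minor_lastrows => [a b ab|x]; first by rewrite !fE; do !case: ifP; lia.
  rewrite inE; apply/orP/existsP => [[/existsP [c]|]|[b]].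
  - have lt_c := ltn_ord c; rewrite modn_lt2; last by lia.
    move=> /eqP cx; have yk : (c.+1 < k)%N by lia.
    by exists (Ordinal yk); rewrite -val_eqE /= fE /= -cx; case: ifP; lia.
  - rewrite modn_lt2; last by lia.
    have k0 : (0 < k)%N by lia.
    by move=> /eqP cx; exists (Ordinal k0); rewrite -val_eqE /= fE /= -cx; case: ifP; lia.
  have lt_b := ltn_ord b; rewrite -val_eqE /= fE => /eqP bx.
  have [b0|b0] := eqVneq (b : nat) 0%N.
    right; rewrite modn_lt2; last by lia.
    by move: bx; rewrite b0 /= => <-; case: ifP; lia.
  left; have yk : (b.-1 < k.-1)%N by lia.
  apply/existsP; exists (Ordinal yk); rewrite modn_lt2 /=; last by lia.
  by rewrite -bx; do !case: ifP; lia.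
rewrite /row_sign -rm ltnSn.
rewrite opp_signr_pred; last by lia.
apply: det_rotate_cols; first by lia.
  move=> a x y xy; rewrite !mxE; congr (g _ _); apply/val_inj; rewrite /= fE val_mucol_rep.
  rewrite /pivot_pos /mucol -rm ltnSn; have := ltn_ord x; have := ltn_ord y.
  by do !case: ifP; lia.
move=> a x y x0 yk; rewrite !mxE; congr (g _ _); apply/val_inj; rewrite /= fE val_mucol_rep.
by rewrite /pivot_pos -rm ltnSn yk eqxx x0 j0.
Qed.

End Minors.

(** * The last k rows and the action of P on them *)

Section BottomRows.
Variables (K : fieldType) (n k : nat) (hk : (1 <= k <= n.-1)%N).
Implicit Types (g p : 'M[K]_n) (r j : 'I_n).
Local Notation lastrow := (lastrow hk).
Local Notation pminor := (pminor hk).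
Local Notation mucol_rep := (mucol_rep hk).
Local Notation pivot := (pivot k).

Definition botrows g : 'M[K]_(k, n) := rowsub lastrow g.

Lemma botrowsE g a j : botrows g a j = g (lastrow a) j.
Proof. by rewrite mxE. Qed.

(** The Levi block through which an element of P acts on the last k rows; all Plücker coordinates
    scale by its determinant. *)
Definition corner p : 'M[K]_k := mxsub lastrow lastrow p.

Lemma sum_lastrow (F : 'I_n -> K) : (forall s : 'I_n, (s < n - k)%N -> F s = 0) ->
  \sum_s F s = \sum_b F (lastrow b).
Proof.
move=> F0; rewrite (bigID (mem [set lastrow b | b in [set: 'I_k]])) /= [X in _ + X]big1.
  rewrite addr0 big_imset /=; first by apply: eq_bigl => b; rewrite inE.
  by move=> a b _ _ /(congr1 val) /= ab; apply/val_inj => /=; lia.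
move=> s; case: (ltnP s (n - k)) => [/F0 //|ms].
suff -> : s \in [set lastrow b | b in [set: 'I_k]] by [].
have := in_lastrows hk s; rewrite inE ms => /esym /existsP [b /eqP <-].
by apply: imset_f; rewrite inE.
Qed.

Lemma botrowsM p g : block_upper (n - k) p -> botrows (p *m g) = corner p *m botrows g.
Proof.
move=> hp; apply/matrixP => a j; rewrite !mxE sum_lastrow.
  by apply: eq_bigr => b _; rewrite !mxE.
by move=> s sm; rewrite hp ?mul0r //=; lia.
Qed.

Lemma corner_det_neq0 p : p \in unitmx -> block_upper (n - k) p -> \det (corner p) != 0.
Proof.
move=> up hp.
have E : corner p *m corner (invmx p) = 1%:M.
  apply/matrixP => a b.
  have := botrowsM (invmx p) hp; rewrite mulmxV // => /matrixP /(_ a (lastrow b)).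
  rewrite !mxE -!val_eqE /= eqn_add2l => ->.
  by apply: eq_bigr => s _; rewrite !mxE.
by have [] := mulmx1_unit E; rewrite unitmxE unitfE.
Qed.

Lemma pminor_replace r x j g : pminor r j g =
  \det (replace_col (\matrix_(a, b) g (lastrow a) (mucol_rep r x b)) (pivot_ord hk r)
          (fun a => g (lastrow a) j)).
Proof.
congr (\det _); apply/matrixP => a b; rewrite !mxE /mucol_rep.
by case: ifP.
Qed.

Lemma pminorM p g r j : block_upper (n - k) p ->
  pminor r j (p *m g) = \det (corner p) * pminor r j g.
Proof.
move=> hp; rewrite -det_mulmx; congr (\det _); apply/matrixP => a b.
have /matrixP /(_ a (mucol_rep r j b)) := botrowsM g hp; rewrite !mxE => ->.
by apply: eq_bigr => s _; rewrite !mxE.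
Qed.

(* The columns of J_(mu_(r+1)) other than [pivot r]. *)
Definition gap r j : bool :=
  if (r < n - k)%N then (r < j < r + k)%N else (j < r - (n - k))%N || (r < j)%N.

Lemma mucol_rep_gap r x b : b != pivot_ord hk r -> gap r (mucol_rep r x b).
Proof.
rewrite -val_eqE /= /gap val_mucol_rep => /negbTE bp; rewrite bp; move: bp.
rewrite /pivot_pos /mucol; have := ltn_ord b; have := ltn_ord r.
by do !case: ifP; lia.
Qed.

Lemma gap_mucol_rep r x j : gap r j -> exists2 b, b != pivot_ord hk r & mucol_rep r x b = j.
Proof.
have := ltn_ord r; have := ltn_ord j; rewrite /gap => lt_jn lt_rn gj.
pose y := if (r < n - k)%N then (j - r.+1)%N else if (r < j)%N then (j - (n - k))%N else j : nat.
have yk : (y < k)%N by rewrite /y; move: gj; do !case: ifP; lia.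
have yp : (y == pivot_pos k r) = false.
  by rewrite /y /pivot_pos; move: gj; do !case: ifP; lia.
exists (Ordinal yk); first by rewrite -val_eqE /= yp.
apply/val_inj; rewrite /= val_mucol_rep /= yp /y /mucol.
by move: gj; do !case: ifP; lia.
Qed.

(** A row-space vector vanishing on the gap columns is fixed by its value at the pivot. The form
    without division applies before p_(mu_(r+1)) is known to be nonzero. *)
Lemma pminor_cramer (z : 'rV[K]_k) g r beta :
    (forall j, gap r j -> (z *m botrows g) 0 j = 0) -> (z *m botrows g) 0 (pivot r) = beta ->
  forall j, (z *m botrows g) 0 j * pminor r (pivot r) g = beta * pminor r j g.
Proof.
move=> zgap zpiv j; pose N : 'M[K]_k := \matrix_(a, b) g (lastrow a) (mucol_rep r (pivot r) b).
rewrite (pminor_replace r (pivot r) j) -/N -(@cramer_row _ _ z N).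
  rewrite mxE; congr (_ * _); apply: eq_bigr => s _; by rewrite mxE.
move=> b; have -> : (z *m N) 0 b = (z *m botrows g) 0 (mucol_rep r (pivot r) b).
  by rewrite !mxE; apply: eq_bigr => s _; rewrite !mxE.
have [->|bp] := eqVneq b (pivot_ord hk r); last by rewrite zgap // mucol_rep_gap.
by rewrite /mucol_rep eqxx zpiv.
Qed.

(** Conversely, the minors themselves, as [j] varies, form a vector of the row space, with
    coefficients a row of an adjugate. That row is built from the other columns, so any filler may
    occupy the slot of the pivot. *)
Lemma pminor_linear r g : exists z : 'rV[K]_k, forall j, pminor r j g = (z *m botrows g) 0 j.
Proof.
pose N : 'M[K]_k := \matrix_(a, b) g (lastrow a) (mucol_rep r r b).
exists (row (pivot_ord hk r) (\adj N)) => j.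
rewrite (pminor_replace r r j) det_replace_col !mxE.
by apply: eq_bigr => s _; rewrite !mxE.
Qed.

(** The column [j] occurs twice; the vanishing is read off as an off-diagonal entry of adj N times
    N. *)
Lemma pminor_gap r j g : gap r j -> pminor r j g = 0.
Proof.
move=> /(gap_mucol_rep r) [b bp bj].
pose N : 'M[K]_k := \matrix_(a, b) g (lastrow a) (mucol_rep r r b).
rewrite (pminor_replace r r j) det_replace_col -/N.
transitivity ((\adj N *m N) (pivot_ord hk r) b).
  by rewrite mxE; apply: eq_bigr => s _; rewrite [N s b]mxE bj.
by rewrite mul_adj_mx mxE eq_sym (negbTE bp).
Qed.

Lemma pminor_unit_neq0 p g r j : p \in unitmx -> block_upper (n - k) p ->
  (pminor r j (p *m g) == 0) = (pminor r j g == 0).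
Proof. by move=> up hp; rewrite pminorM // mulf_eq0 (negbTE (corner_det_neq0 up hp)). Qed.

Lemma pmuM (i : nat) p g : (i <= n)%N -> block_upper (n - k) p ->
  pmu k i (p *m g) = \det (corner p) * pmu k i g.
Proof.
have [->|i0] := eqVneq i 0%N => le_in hp; last first.
  have lt_in : (i.-1 < n)%N by lia.
  have -> : i = (Ordinal lt_in).+1 by rewrite /= prednK // lt0n.
  by rewrite !pmu_pminor pminorM.
have lt0n : (0 < n)%N by lia.
by have := pmu_pminor_diag hk (Ordinal lt0n) => /= E; rewrite !E pminorM // mulrCA.
Qed.

Lemma pmuhatM r p g : block_upper (n - k) p ->
  pmuhat k r.+1 (p *m g) = \det (corner p) * pmuhat k r.+1 g.
Proof.
move=> hp; have lt_rn := ltn_ord r; have [rm|rm] := eqVneq r.+1 (n - k)%N.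
  have lt0n : (0 < n)%N by lia.
  by rewrite !(pmuhat_pminor_corner hk (j := Ordinal lt0n) _ rm) // pminorM // mulrCA.
have lt_pn : ((pivot r).+1 < n)%N by rewrite val_pivot //; case: ifP; lia.
by rewrite !(pmuhat_pminor hk (j := Ordinal lt_pn) _ rm) // pminorM.
Qed.

Lemma superpotentialM p g q : block_upper (n - k) p -> \det (corner p) = 1 ->
  superpotential k (p *m g) q = superpotential k g q.
Proof.
move=> hp det1; rewrite /superpotential ![\sum_(1 <= i < n.+1) _]big_add1 !big_mkord.
by apply: eq_bigr => r _; rewrite pmuhatM // pmuM // det1 !mul1r.
Qed.

End BottomRows.

Section SuperdiagonalSum.
Variables (K : fieldType) (n : nat).
Implicit Types u : 'M[K]_n.

(* Zero in the last row. *)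
Definition superdiag u (r : 'I_n) : K := \sum_(s : 'I_n | s == r.+1 :> nat) u r s.

Lemma superdiagE u (r s : 'I_n) : s = r.+1 :> nat -> superdiag u r = u r s.
Proof.
move=> sr; rewrite /superdiag (big_pred1 s) // => x.
by rewrite /= -val_eqE /= sr.
Qed.

Lemma superdiag_last u (r : 'I_n) : r.+1 = n -> superdiag u r = 0.
Proof.
move=> rn; rewrite /superdiag big_pred0 // => x.
by apply/negbTE; have := ltn_ord x; lia.
Qed.

End SuperdiagonalSum.

Lemma simple_sum_superdiag (K : fieldType) (n : nat) (u : 'M[K]_n) :
  simple_sum u = \sum_r superdiag u r.
Proof.
case: n u => [|n'] u; first by rewrite /simple_sum !big_ord0.
rewrite /simple_sum big_ord_recr /= superdiag_last // addr0.
apply: eq_bigr => l _; rewrite (@superdiagE _ _ _ _ (@shi n'.+1 l)) //.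
by congr (u _ _); apply/val_inj.
Qed.

(** * Elements of the intersection of B_- with U_+ M U_+ *)

Section UnipotentCell.
Variables (K : fieldType) (n k : nat) (hk : (1 <= k <= n.-1)%N).
Implicit Types (b g u : 'M[K]_n) (r s j : 'I_n).
Local Notation lastrow := (lastrow hk).
Local Notation pminor := (pminor hk).
Local Notation pivot := (@pivot n k).
Local Notation botrows := (botrows hk).
Local Notation row_sign := (@row_sign K n k).

Definition pivot_sign r : K := if (r < n - k)%N then (-1) ^+ k else 1.

(* The block matrix with blocks (-1)^k and 1 on the antidiagonal; it is the
   product of the representative of w_P and the inverse of that of w_0. *)
Definition pivotmx : 'M[K]_n := \matrix_(r, j) (pivot_sign r * (pivot r == j)%:R).

Lemma mul_pivotmx u r j : (pivotmx *m u) r j = pivot_sign r * u (pivot r) j.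
Proof.
rewrite mxE (bigD1 (pivot r)) //= big1 ?addr0 => [|s /negbTE sp]; rewrite mxE.
  by rewrite eqxx mulr1.
by rewrite eq_sym sp mulr0 mul0r.
Qed.

Lemma pivot_sign_sqr r : pivot_sign r * pivot_sign r = 1.
Proof. by rewrite /pivot_sign; case: ifP; rewrite ?mulr1 // -expr2 sqrr_sign. Qed.

Lemma pivotmx_tr : pivotmx *m pivotmx^T = 1%:M.
Proof.
apply/matrixP => r s; rewrite mul_pivotmx !mxE (inj_eq (pivot_inj hk)) eq_sym.
by case: eqP => [->|_]; rewrite ?mulr0 // mulr1 pivot_sign_sqr.
Qed.

Section Decomposition.
Variables (b u1 u2 : 'M[K]_n).
Hypotheses (bB : Bminus b) (u1U : Uplus u1) (u2U : Uplus u2).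
Hypothesis bE : b = u1 *m pivotmx *m u2.

Let m := (n - k)%N.
(** The entries of M u_2: row [s] starts at column [pivot s], with value [pivot_sign s]. *)
Let w s j : K := pivot_sign s * u2 (pivot s) j.
Let Q r s : bool := (s < m)%N == (r < m)%N.

Let u1_upper r s : (s < r)%N -> u1 r s = 0. Proof. by case: u1U => -[_ h _]; exact: h. Qed.
Let u2_upper r s : (s < r)%N -> u2 r s = 0. Proof. by case: u2U => -[_ h _]; exact: h. Qed.
Let u1_diag r : u1 r r = 1. Proof. by case: u1U. Qed.
Let u2_diag r : u2 r r = 1. Proof. by case: u2U. Qed.

Let w_zero s j : (j < pivot s)%N -> w s j = 0.
Proof. by move=> js; rewrite /w u2_upper // mulr0. Qed.

Let b_sum r j : b r j = \sum_s u1 r s * w s j.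
Proof. by rewrite bE -mulmxA mxE; apply: eq_bigr => s _; rewrite mul_pivotmx. Qed.

(** M u_2 = u_1^-1 b, and the rows s >= m of u_1^-1 are supported on the last k columns; so those
    rows of M u_2 are combinations of the last k rows of b. *)
Let bottom_sum r : exists z : 'rV[K]_k,
  forall j, (z *m botrows b) 0 j = \sum_(s : 'I_n | (m <= s)%N) u1 r s * w s j.
Proof.
have uu1 : u1 \in unitmx by case: u1U => -[].
exists (\row_a \sum_(s : 'I_n | (m <= s)%N) u1 r s * invmx u1 s (lastrow a)) => j.
rewrite mxE; under eq_bigr => a _ do rewrite !mxE mulr_suml.
rewrite exchange_big /=; apply: eq_bigr => s ms.
under eq_bigr => a _ do rewrite -mulrA.
rewrite -mulr_sumr; congr (_ * _).
have [[_ iup] _] := UplusV u1U.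
rewrite -(@sum_lastrow _ _ _ hk (fun x => invmx u1 s x * b x j)); last first.
  by move=> x xm; rewrite iup ?mul0r //; lia.
transitivity ((invmx u1 *m b) s j); first by rewrite mxE.
by rewrite bE -mulmxA mulKmx // mul_pivotmx.
Qed.

(** [pivot] increases within a block and u_1 leaves only rows s >= r, so row [r] is the first of
    them to start. *)
Let same_block_zero r j : (j < pivot r)%N -> \sum_(s | Q r s) u1 r s * w s j = 0.
Proof.
rewrite val_pivot // => jr; rewrite big1 // => s; rewrite /Q => /eqP Qs.
case: (ltnP s r) => sr; first by rewrite u1_upper ?mul0r.
rewrite w_zero ?mulr0 // val_pivot //; move: Qs jr; rewrite -/m.
by do !case: ifP; lia.
Qed.

Let same_block_pivot r : \sum_(s | Q r s) u1 r s * w s (pivot r) = pivot_sign r.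
Proof.
rewrite (bigD1 r) /=; last by rewrite /Q.
rewrite big1 ?addr0 /w ?u1_diag ?mul1r ?u2_diag ?mulr1 // => s /andP[/eqP Qs sr].
case: (ltngtP s r) => [lt|gt|/val_inj E]; first by rewrite u1_upper ?mul0r.
  rewrite -/(w s _) w_zero ?mulr0 // !val_pivot //; move: Qs gt; rewrite -/m.
  by do !case: ifP; lia.
by rewrite E eqxx in sr.
Qed.

(** Only rows r and r + 1 reach this column: the first contributes an entry of u_2, the second an
    entry of u_1. The hypothesis keeps r + 1 in the same block. *)
Let same_block_succ r j : r.+1 != m -> j = (pivot r).+1 :> nat ->
  \sum_(s | Q r s) u1 r s * w s j = pivot_sign r * (superdiag u2 (pivot r) + superdiag u1 r).
Proof.
move=> rm jE; rewrite (superdiagE u2 jE) mulrDr (bigD1 r) /=; last by rewrite /Q.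
rewrite u1_diag mul1r /w; congr (_ + _); rewrite -/(w _ _).
have lt_rn := ltn_ord r.
have [rn|rn] := eqVneq r.+1 n.
  rewrite superdiag_last // mulr0 big1 // => s /andP[_ sr].
  rewrite u1_upper ?mul0r //.
  by move: sr; rewrite -val_eqE /=; have := ltn_ord s; lia.
have lt_Sn : (r.+1 < n)%N by lia.
pose r1 : 'I_n := Ordinal lt_Sn.
rewrite (superdiagE u1 (s := r1)) // (bigD1 r1) /=; last first.
  by rewrite /Q -val_eqE /=; move: rm; rewrite /m; lia.
rewrite big1 ?addr0 => [|s /andP[/andP[/eqP Qs sr] sr1]].
  have -> : j = pivot r1.
    apply/val_inj; rewrite /= jE !val_pivot //=; move: rm; rewrite /m.
    by do !case: ifP; lia.
  rewrite u2_diag mulr1 mulrC; congr (_ * _).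
  rewrite /pivot_sign /=.
  by have -> : (r.+1 < n - k)%N = (r < n - k)%N by move: rm; rewrite /m; lia.
case: (ltnP s r) => lt; first by rewrite u1_upper ?mul0r.
rewrite -/(w s j) w_zero ?mulr0 // jE !val_pivot //.
move: Qs sr sr1; rewrite -!val_eqE /= -/m.
by do !case: ifP; lia.
Qed.

(** The vector is the part of row r of b coming from the rows s >= m of M u_2. The remaining rows
    start at column s + k, so with s >= r they contribute nothing up to the diagonal. *)
Lemma cell_row r : exists z : 'rV[K]_k,
  [/\ forall j, (j <= r)%N -> (z *m botrows b) 0 j = b r j,
      forall j, gap k r j -> (z *m botrows b) 0 j = 0,
      (z *m botrows b) 0 (pivot r) = row_sign r,
      r.+1 != m -> forall j, j = (pivot r).+1 :> nat -> (z *m botrows b) 0 j =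
        row_sign r * (superdiag u2 (pivot r) + superdiag u1 r) &
      r.+1 = m -> forall j, j = 0%N :> nat -> (z *m botrows b) 0 j = superdiag u1 r].
Proof.
have [z zE] := bottom_sum r; exists z.
have lt_rn := ltn_ord r.
have b_upper j : (r < j)%N -> b r j = 0 by case: bB => _ h; exact: h.
have split_b j : b r j = \sum_(s : 'I_n | (s < m)%N) u1 r s * w s j + (z *m botrows b) 0 j.
  rewrite zE b_sum (bigID (fun s : 'I_n => (s < m)%N)) /=; congr (_ + _).
  by apply: eq_bigl => s; rewrite -leqNgt.
(* Right of the diagonal b vanishes, so in a top row the bottom part is minus the top part; this is
   the origin of the minus sign in [row_sign]. *)
have yE j : (r < j)%N \/ (m <= r)%N ->
    (z *m botrows b) 0 j = (if (r < m)%N then -1 else 1) * \sum_(s | Q r s) u1 r s * w s j.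
  case: (ltnP r m) => rm; last first.
    by rewrite mul1r zE => _; apply: eq_bigl => s; rewrite /Q; lia.
  case=> [rj|]; last by lia.
  have := split_b j; rewrite b_upper // mulN1r => /eqP; rewrite eq_sym addrC addr_eq0.
  by move=> /eqP ->; congr (- _); apply: eq_bigl => s; rewrite /Q rm eqb_id.
have sgE : (if (r < m)%N then -1 else 1) * pivot_sign r = row_sign r.
  by rewrite /pivot_sign /row_sign -/m; case: ifP; rewrite ?mulN1r ?mulr1.
have piv_r : (r < pivot r)%N \/ (m <= r)%N.
  by case: (ltnP r m) => rm; [left; rewrite val_pivot // -/m rm; lia | right].
split=> [j jr|j|||].
- rewrite split_b big1 ?add0r // => s sm.
  case: (ltnP s r) => sr; first by rewrite u1_upper ?mul0r.
  by rewrite w_zero ?mulr0 // val_pivot // -/m sm; lia.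
- rewrite /gap -/m; case: (ltnP r m) => rm.
    move=> rj; rewrite yE; last by left; lia.
    by rewrite same_block_zero ?mulr0 // val_pivot // -/m rm; lia.
  case/orP => jr.
    rewrite yE; last by right.
    by rewrite same_block_zero ?mulr0 // val_pivot // -/m; case: ifP; lia.
  have := split_b j; rewrite b_upper // big1 ?add0r // => s sm.
  by rewrite u1_upper ?mul0r //; lia.
- by rewrite yE // same_block_pivot sgE.
- move=> rm j jE; rewrite yE; last by case: piv_r; [left; lia | right].
  by rewrite same_block_succ // mulrA sgE.
move=> rm j j0; rewrite zE.
have lt_mn : (m < n)%N by lia.
pose r1 : 'I_n := Ordinal lt_mn.
(* Among the rows s >= m, only row m, with pivot 0, is nonzero in column 0. *)
rewrite (bigD1 r1) //= big1 ?addr0 => [|s /andP[ms sr1]].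
  rewrite (superdiagE u1 (s := r1)) //; have -> : j = pivot r1.
    by apply/val_inj; rewrite /= j0 val_pivot //= -/m ltnn subnn.
  by rewrite /w u2_diag /pivot_sign /= -/m ltnn !mulr1.
rewrite w_zero ?mulr0 // val_pivot // -/m j0; move: sr1; rewrite -val_eqE /=.
by case: ifP; lia.
Qed.

Lemma cell_diag r : b r r * pmu k r.+1 b = pmu k r b.
Proof.
have [z [zb zgap zpiv _ _]] := cell_row r.
by rewrite -zb // (pmu_pminor_diag hk) (pmu_pminor hk) (pminor_cramer zgap zpiv).
Qed.

(** In the last k rows the entries left of the pivot vanish and the pivot entry is 1, so the minor
    on the first k columns is unitriangular. *)
Lemma cell_pmu_last : pmu k n b = 1.
Proof.
have le_kn : (k <= n)%N by lia.
rewrite (pmu_det hk (f := widen_ord le_kn)) //; last first.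
  by move=> c /=; have := ltn_ord c; rewrite /mucol; do !case: ifP; lia.
rewrite -det_tr det_trig.
  rewrite big1 // => a _; rewrite !mxE.
  have [z [zb _ zpiv _ _]] := cell_row (lastrow a).
  have E : widen_ord le_kn a = pivot (lastrow a).
    by apply/val_inj; rewrite /= val_pivot //=; case: ifP; lia.
  rewrite -zb /=; last exact: leq_addl.
  by rewrite E zpiv /row_sign /= ltnNge leq_addr.
apply/is_trig_mxP => i j ij; rewrite !mxE.
have [z [zb zgap _ _ _]] := cell_row (lastrow j).
rewrite -zb /=; last by lia.
by apply: zgap; rewrite /gap /=; case: ifP; lia.
Qed.

(** Descent from p_(mu_n) = 1: each step multiplies by a diagonal entry of b. *)
Lemma cell_pmu_neq0 (i : nat) : (i <= n)%N -> pmu k i b != 0.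
Proof.
have bdiag r : b r r != 0.
  by move: bB; rewrite Bminus_tr => /(Bplus_diag_neq0 r); rewrite mxE.
suff H d : (d <= n)%N -> pmu k (n - d) b != 0.
  by move=> le_in; have := H (n - i)%N; rewrite subKn //; apply; exact: leq_subr.
elim: d => [|d ih] dn; first by rewrite subn0 cell_pmu_last oner_neq0.
have lt_n : (n - d.+1 < n)%N by lia.
have := cell_diag (Ordinal lt_n); rewrite /= => <-.
rewrite mulf_neq0 ?bdiag // -[X in pmu k X](_ : (n - d)%N = _); last by lia.
by apply: ih; lia.
Qed.

Lemma cell_pmuhat r :
  pmuhat k r.+1 b = pmu k r.+1 b * (superdiag u2 (pivot r) + superdiag u1 r).
Proof.
have [z [_ zgap zpiv zsucc zcorner]] := cell_row r.
have lt_rn := ltn_ord r; have cr := pminor_cramer zgap zpiv.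
rewrite (pmu_pminor hk); have [rm|rm] := eqVneq r.+1 m.
  have lt0n : (0 < n)%N by lia.
  rewrite (pmuhat_pminor_corner hk (j := Ordinal lt0n)) // -cr.
  have p_last : (pivot r).+1 = n by rewrite val_pivot //; move: rm; rewrite /m; case: ifP; lia.
  by rewrite (zcorner rm (Ordinal lt0n)) // (superdiag_last u2 p_last) add0r mulrC.
have lt_pn : ((pivot r).+1 < n)%N.
  by rewrite val_pivot //; move: rm; rewrite /m; case: ifP; lia.
rewrite (pmuhat_pminor hk (j := Ordinal lt_pn)) //.
apply: (mulfI (row_sign_neq0 K k r)); rewrite -cr (zsucc rm) // -mulrA.
by congr (_ * _); rewrite mulrC.
Qed.

Lemma cell_superpotential q : superpotential k b q =
  \sum_r superdiag u2 r + \sum_r superdiag u1 r * q ^+ (r.+1 == m)%N.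
Proof.
rewrite (reindex_inj (pivot_inj hk)) -big_split /superpotential /=.
rewrite big_add1 /= big_mkord; apply: eq_bigr => r _.
rewrite cell_pmuhat [X in X * _]mulrC mulKf ?cell_pmu_neq0 // mulrDl; congr (_ + _).
(* In the term carrying q the pivot is the last column, where u_2 has no superdiagonal entry; so q
   multiplies an entry of u_1 only. *)
case: eqP => [rm|_]; last by rewrite mulr1.
rewrite superdiag_last ?mul0r // val_pivot //; have := ltn_ord r; move: rm.
by rewrite /m; case: ifP; lia.
Qed.

End Decomposition.

End UnipotentCell.

(** * The inverse of pi_L on representatives *)

Section CosetSection.
Variables (K : fieldType) (n k : nat) (hk : (1 <= k <= n.-1)%N).
Implicit Types (b g u p : 'M[K]_n) (r s j : 'I_n).
Local Notation lastrow := (lastrow hk).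
Local Notation pminor := (pminor hk).
Local Notation pivot := (@pivot n k).
Local Notation botrows := (botrows hk).
Local Notation row_sign := (@row_sign K n k).
Local Notation pivotmx := (@pivotmx K n k).
Local Notation pivot_sign := (@pivot_sign K n k).

Definition cell b : Prop :=
  Bminus b /\ exists u1 u2, [/\ Uplus u1, Uplus u2 & b = u1 *m pivotmx *m u2].

(** Cramer's value up to the diagonal and 0 beyond, which forces B_-. Numerator and denominator are
    kept apart because regularity is a statement about fractions. *)
Definition section_num r j g : K := if (j <= r)%N then row_sign r * pminor r j g else 0.

Definition section_den r j g : K := pminor r (pivot r) g.

Definition section_mx g : 'M[K]_n := \matrix_(r, j) (section_num r j g / section_den r j g).

Lemma pminor_poly r j : mxpolyfun (fun g : 'M[K]_n => pminor r j g).
Proof. by apply: mxpolyfun_det => a c; under eq_fun do rewrite mxE; exact: MxPolyCoord. Qed.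

Lemma section_num_poly r j : mxpolyfun (section_num r j).
Proof.
rewrite /section_num; case: (j <= r)%N; last exact: MxPolyConst.
by apply: MxPolyMul; [exact: MxPolyConst | exact: pminor_poly].
Qed.

Lemma section_den_poly r j : mxpolyfun (section_den r j).
Proof. exact: pminor_poly. Qed.

Lemma section_denE r j g : section_den r j g = pmu k r.+1 g.
Proof. by rewrite (pmu_pminor hk). Qed.

Lemma section_mxM p g : p \in unitmx -> block_upper (n - k) p ->
  section_mx (p *m g) = section_mx g.
Proof.
move=> up hp; apply/matrixP => r j; rewrite !mxE /section_num /section_den.
case: ifP => _; last by rewrite !mul0r.
have c0 := corner_det_neq0 hk up hp.
by rewrite !pminorM // mulrCA -mulf_div divff // mul1r.
Qed.

Lemma section_mx_cell b : cell b -> section_mx b = b.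
Proof.
move=> [bB [u1 [u2 [u1U u2U bE]]]]; apply/matrixP => r j; rewrite mxE /section_num.
case: leqP => jr; last by rewrite mul0r; case: bB => _ ->.
have [z [zb zgap zpiv _ _]] := cell_row hk bB u1U u2U bE r.
rewrite -(pminor_cramer zgap zpiv) zb // mulfK // -pmu_pminor.
exact: (cell_pmu_neq0 hk bB u1U u2U bE).
Qed.

Section OpenCell.
Variable g : 'M[K]_n.
Hypotheses (gG : g \in unitmx) (gdom : forall r, pminor r (pivot r) g != 0).

Let b := section_mx g.
(** The untruncated matrix. Its rows lie in the row space of the last k rows of g, and it agrees
    with [b] in those rows, where all columns right of the diagonal are gaps. *)
Let y r j : K := row_sign r * pminor r j g / pminor r (pivot r) g.

Let bE r j : b r j = if (j <= r)%N then y r j else 0.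
Proof. by rewrite mxE /section_num; case: ifP; rewrite ?mul0r. Qed.

Let y_gap r j : gap k r j -> y r j = 0.
Proof. by move=> rj; rewrite /y pminor_gap // mulr0 mul0r. Qed.

Let y_pivot r : y r (pivot r) = row_sign r.
Proof. by rewrite /y mulfK. Qed.

Let b_bot r j : (n - k <= r)%N -> b r j = y r j.
Proof.
move=> mr; rewrite bE; case: leqP => // rj; rewrite y_gap // /gap rj orbT.
by case: ifP; lia.
Qed.

Let b_lower r s : (r < s)%N -> b r s = 0.
Proof. by move=> rs; rewrite bE leqNgt rs. Qed.

Let b_Bminus : Bminus b.
Proof.
split=> [|r s]; last exact: b_lower.
rewrite -unitmx_tr; apply: upper_unit => [i j ji|r]; first by rewrite mxE b_lower.
rewrite mxE bE leqnn /y -pmu_pminor_diag mulf_neq0 ?invr_eq0 //.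
have lt_rn := ltn_ord r; have [r0|r0] := eqVneq (r : nat) 0%N.
  rewrite r0 (pmu0 k).
  have lt_n : (n.-1 < n)%N by lia.
  by have := pmu_pminor hk (Ordinal lt_n) g; rewrite /= prednK; [move=> -> | lia].
have lt_n : (r.-1 < n)%N by lia.
by have := pmu_pminor hk (Ordinal lt_n) g; rewrite /= prednK; [move=> -> | lia].
Qed.

Let y_linear : exists X : 'M[K]_(n, k), forall r j, y r j = (X *m botrows g) r j.
Proof.
have /boolp.choice [z zE] r := pminor_linear hk r g.
exists (\matrix_(r, a) (row_sign r / pminor r (pivot r) g * z r 0 a)) => r j.
rewrite /y zE !mxE mulrAC mulr_sumr; apply: eq_bigr => a _.
by rewrite !mxE mulrA.
Qed.

(** The first k columns of the last k rows of [b] are triangular with nonzero diagonal, which forces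
    the coefficient matrix to be invertible. *)
Let bottom_linear : exists2 X : 'M[K]_k, X \in unitmx & botrows b = X *m botrows g.
Proof.
have [X yE] := y_linear; exists (rowsub lastrow X); last first.
  apply/matrixP => a j; rewrite botrowsE b_bot /= ?leq_addr // yE.
  by rewrite mul_rowsub_mx [RHS]mxE.
have le_kn : (k <= n)%N by lia.
have E : rowsub lastrow X *m colsub (widen_ord le_kn) (botrows g)
         = colsub (widen_ord le_kn) (botrows b).
  apply/matrixP => a j; rewrite [RHS]mxE botrowsE b_bot /= ?leq_addr // yE.
  by rewrite !mxE; apply: eq_bigr => s _; rewrite !mxE.
suff : colsub (widen_ord le_kn) (botrows b) \in unitmx.
  by rewrite -E unitmx_mul => /andP[].
apply: upper_unit => [i j ji|i]; rewrite mxE botrowsE b_bot /= ?leq_addr //.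
  by rewrite y_gap // /gap /=; case: ifP; lia.
have -> : widen_ord le_kn i = pivot (lastrow i).
  by apply/val_inj; rewrite /= val_pivot //=; case: ifP; lia.
by rewrite y_pivot row_sign_neq0.
Qed.

Lemma section_mx_coset : parabolic k (b *m invmx g).
Proof.
apply/parabolicP; split; first by rewrite unitmx_mul unitmx_inv gG andbT; case: b_Bminus.
move=> i j mi jm.
have := in_lastrows hk i; rewrite inE mi => /esym /existsP [a /eqP <-].
have [X _ XE] := bottom_linear.
have : botrows b *m invmx g = X *m botrows 1%:M.
  by rewrite XE /botrows -mulmxA mul_rowsub_mx mulmxV.
move=> /matrixP /(_ a j); rewrite mul_rowsub_mx mxE => ->.
rewrite mxE big1 // => s _; rewrite !mxE -val_eqE /=.
by case: eqP; rewrite ?mulr0 //; lia.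
Qed.

(** Row reduction: for a top row, [y r] is a combination of the last k rows of [b]. Subtracting it
    clears row r before column [pivot r] and leaves -[row_sign] = [pivot_sign] there. The operation
    is a unipotent [v], so u_1 = v^-1 and u_2 = M^-1 v b. *)
Lemma section_mx_in_cell : cell b.
Proof.
split=> //; have [X Xu XE] := bottom_linear; have [Y yE] := y_linear.
pose C : 'M[K]_(n, k) := \matrix_(r, a) if (r < n - k)%N then (Y *m invmx X) r a else 0.
pose v : 'M[K]_n := 1%:M - C *m botrows 1%:M.
have CE r j : (C *m botrows b) r j = if (r < n - k)%N then y r j else 0.
  rewrite mxE; case: ifP => rm; last by rewrite big1 // => a _; rewrite mxE rm mul0r.
  transitivity ((Y *m invmx X *m botrows b) r j).
    by rewrite [RHS]mxE; apply: eq_bigr => a _; rewrite mxE rm.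
  by rewrite XE mulmxA mulmxKV // yE.
have vE r s : (s <= r)%N -> v r s = (r == s)%:R.
  move=> sr; rewrite !mxE big1 ?subr0 // => a _; rewrite !mxE -val_eqE /=.
  case: ifP => rm; last by rewrite mul0r.
  by case: eqP; rewrite ?mulr0 //; lia.
have vU : Uplus v.
  have vup r s : (s < r)%N -> v r s = 0.
    by move=> sr; rewrite vE ?(ltnW sr) // -val_eqE /= gtn_eqF.
  split=> [|r]; last by rewrite vE // eqxx.
  by split=> //; apply: upper_unit => // r; rewrite vE // eqxx oner_neq0.
have vb r j : (v *m b) r j = b r j - (if (r < n - k)%N then y r j else 0).
  rewrite mulmxBl mul1mx -mulmxA /botrows mul_rowsub_mx mul1mx -/(botrows b).
  by rewrite mxE [X in _ + X]mxE CE.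
have vb_zero r j : (j < pivot r)%N -> (v *m b) r j = 0.
  rewrite vb val_pivot // bE; case: ifP => rm jp.
    case: leqP => jr; first by rewrite subrr.
    by rewrite y_gap ?subr0 // /gap rm; lia.
  rewrite subr0; case: leqP => // jr; rewrite y_gap // /gap rm; lia.
have vb_pivot r : (v *m b) r (pivot r) = pivot_sign r.
  rewrite vb bE y_pivot val_pivot // /pivot_sign /row_sign; have := ltn_ord r.
  by do !case: ifP; rewrite ?subr0 ?sub0r ?opprK //; lia.
have MM := pivotmx_tr K hk.
pose u2 := pivotmx^T *m (v *m b).
have u2E i j : u2 i j = \sum_(r | pivot r == i) pivot_sign r * (v *m b) r j.
  rewrite mxE [RHS]big_mkcond; apply: eq_bigr => r _; rewrite !mxE.
  by case: eqP; rewrite ?mulr1 // mulr0 mul0r.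
have u2up (i j : 'I_n) : (j < i)%N -> u2 i j = 0.
  by move=> ji; rewrite u2E big1 // => r /eqP pr; rewrite vb_zero ?mulr0 // pr.
have u2diag i : u2 i i = 1.
  have [f _ fK] := injF_bij (pivot_inj hk).
  rewrite u2E (big_pred1 (f i)); first by rewrite -[X in (v *m b) _ X](fK i) vb_pivot pivot_sign_sqr.
  by move=> r /=; rewrite -{1}(fK i) (inj_eq (pivot_inj hk)).
have vu : v \in unitmx by case: vU => -[].
exists (invmx v), u2; split; first exact: UplusV.
  split=> //; split=> //; apply: upper_unit => // i; by rewrite u2diag oner_neq0.
by rewrite /u2 -mulmxA [pivotmx *m _]mulmxA MM mul1mx mulKmx.
Qed.

End OpenCell.

End CosetSection.

(** * Cosets, reflection in the antidiagonal and the torus *)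

Section Cosets.
Variables (K : fieldType) (n : nat).
Implicit Types g h p : 'M[K]_n.

Lemma parabolic_unit k p : parabolic k p -> p \in unitmx.
Proof. by case/parabolicP. Qed.

Lemma parabolicM k p h : parabolic k p -> parabolic k h -> parabolic k (p *m h).
Proof.
rewrite !parabolicP => -[up hp] [uh hh]; split; first by rewrite unitmx_mul up.
exact: block_upperM.
Qed.

Lemma parabolicV k p : parabolic k p -> parabolic k (invmx p).
Proof. by rewrite !parabolicP unitmx_inv => -[up hp]; split=> //; exact: block_upperV. Qed.

Lemma Bplus_parabolic k p : Bplus p -> parabolic k p.
Proof. by move=> [up /upper_block hp]; apply/parabolicP. Qed.

Lemma rcoset_parabolicP k g g' :
  rcosetmx (@parabolic K n k) g = rcosetmx (@parabolic K n k) g' <->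
  exists2 p, parabolic k p & g' = p *m g.
Proof.
split=> [E|[p hp ->]].
  have : rcosetmx (@parabolic K n k) g' g'.
    by exists 1%:M; [apply: Bplus_parabolic; exact: Bplus1 | rewrite mul1mx].
  by rewrite -E => -[p hp <-]; exists p.
have up := parabolic_unit hp.
apply/seteqP; split=> _ [h hh <-].
  by exists (h *m invmx p); [apply: parabolicM => //; exact: parabolicV | rewrite mulmxA mulmxKV].
by exists (h *m p); [exact: parabolicM | rewrite mulmxA].
Qed.

Lemma lcoset_BminusP g g' :
  lcosetmx (@Bminus K n) g = lcosetmx (@Bminus K n) g' <->
  exists2 p, Bminus p & g' = g *m p.
Proof.
split=> [E|[p hp ->]].
  have : lcosetmx (@Bminus K n) g' g' by exists 1%:M; [exact: Bminus1 | rewrite mulmx1].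
  by rewrite -E => -[p hp <-]; exists p.
have up : p \in unitmx by case: hp.
apply/seteqP; split=> _ [h hh <-].
  exists (invmx p *m h); first by apply: BminusM => //; exact: BminusV.
  by rewrite mulmxA mulmxK.
by exists (p *m h); [exact: BminusM | rewrite mulmxA].
Qed.

End Cosets.

Section AntiTranspose.
Variables (K : fieldType) (n : nat).
Implicit Types A B : 'M[K]_n.

(* Reflection in the antidiagonal: an anti-automorphism preserving B_-, U_+ and
   the cell, and exchanging the last k rows with the first k columns. *)
Definition antitr A : 'M[K]_n := \matrix_(i, j) A (rev_ord j) (rev_ord i).

Lemma antitrK : involutive antitr.
Proof. by move=> A; apply/matrixP => i j; rewrite !mxE !rev_ordK. Qed.

Lemma antitrM A B : antitr (A *m B) = antitr B *m antitr A.
Proof.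
apply/matrixP => i j; rewrite !mxE (reindex_inj rev_ord_inj); apply: eq_bigr => s _.
by rewrite !mxE mulrC.
Qed.

Lemma antitr1 : antitr 1%:M = 1%:M.
Proof. by apply/matrixP => i j; rewrite !mxE (inj_eq rev_ord_inj) eq_sym. Qed.

Lemma antitr_unit A : A \in unitmx -> antitr A \in unitmx.
Proof.
move=> uA; have : antitr A *m antitr (invmx A) = 1%:M by rewrite -antitrM mulVmx // antitr1.
by case/mulmx1_unit.
Qed.

Lemma antitr_Bplus A : Bplus A -> Bplus (antitr A).
Proof.
move=> [uA hA]; split=> [|i j ji]; first exact: antitr_unit.
by rewrite mxE hA //=; have := ltn_ord i; lia.
Qed.

Lemma antitr_Bminus A : Bminus A -> Bminus (antitr A).
Proof.
move=> [uA hA]; split=> [|i j ji]; first exact: antitr_unit.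
by rewrite mxE hA //=; have := ltn_ord j; lia.
Qed.

Lemma antitr_Uplus A : Uplus A -> Uplus (antitr A).
Proof. by move=> [hA A1]; split=> [|i]; [exact: antitr_Bplus | rewrite mxE]. Qed.

(** The reflection fixes M and reverses products, so u_1 and u_2 change places. *)
Lemma antitr_cell k A : (1 <= k <= n.-1)%N -> cell k A -> cell k (antitr A).
Proof.
move=> hk [AB [u1 [u2 [u1U u2U AE]]]]; split; first exact: antitr_Bminus.
exists (antitr u2), (antitr u1); split; [exact: antitr_Uplus | exact: antitr_Uplus |].
rewrite AE !antitrM mulmxA; congr (_ *m _ *m _); apply/matrixP => i j; rewrite !mxE.
have lt_in := ltn_ord i; have lt_jn := ltn_ord j.
rewrite /pivot_sign -!val_eqE /= !val_pivot //=.
by case: eqP => E1; case: eqP => E2; rewrite ?mulr0 //; move: E1 E2; do !case: ifP => //; lia.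
Qed.

End AntiTranspose.

Section Torus.
Variables (K : fieldType) (n : nat).
Implicit Types (A : 'M[K]_n) (d : 'rV[K]_n).

Lemma diag_mx_Bplus d : (forall i, d 0 i != 0) -> Bplus (diag_mx d).
Proof.
move=> d0.
have up (i j : 'I_n) : (j < i)%N -> diag_mx d i j = 0.
  by move=> ji; rewrite mxE -val_eqE /= gtn_eqF.
by split=> //; apply: upper_unit => // i; rewrite mxE eqxx mulr1n.
Qed.

Lemma diag_mx_Bminus d : (forall i, d 0 i != 0) -> Bminus (diag_mx d).
Proof. by move=> d0; rewrite Bminus_tr tr_diag_mx; exact: diag_mx_Bplus. Qed.

Variable k : nat.

Lemma torusP_Bplus (q : K) : q != 0 -> Bplus (torusP n k q).
Proof. by move=> q0; apply: diag_mx_Bplus => i; rewrite mxE; case: ifP; rewrite ?oner_neq0. Qed.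

Lemma torusP_Bminus (q : K) : q != 0 -> Bminus (torusP n k q).
Proof. by move=> q0; apply: diag_mx_Bminus => i; rewrite mxE; case: ifP; rewrite ?oner_neq0. Qed.

Lemma torusPM (q q' : K) : torusP n k q *m torusP n k q' = torusP n k (q * q').
Proof.
apply/matrixP => i j; rewrite mul_diag_mx !mxE.
by case: ifP; rewrite ?mulrnAr ?mulr1.
Qed.

Lemma torusP1 : torusP n k (1 : K) = 1%:M.
Proof. by apply/matrixP => i j; rewrite !mxE if_same. Qed.

Lemma torusPV (q : K) A : q != 0 -> torusP n k q^-1 *m (torusP n k q *m A) = A.
Proof. by move=> q0; rewrite mulmxA torusPM mulVf // torusP1 mul1mx. Qed.

Lemma torusPVK (q : K) A : q != 0 -> torusP n k q *m (torusP n k q^-1 *m A) = A.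
Proof. by move=> q0; rewrite mulmxA torusPM mulfV // torusP1 mul1mx. Qed.

End Torus.

(** * The isomorphisms pi_L and pi_R *)

Section Isomorphisms.
Variables (K : fieldType) (n k : nat) (hk : (1 <= k <= n.-1)%N).
Variables (wP w0 : 'M[K]_n).
Hypothesis w0E : forall i j : 'I_n, w0 i j = (-1) ^+ i * (rev_ord i == j)%:R.
Hypothesis wPE : wP = pivotmx K n k *m w0.
Implicit Types (A b g : 'M[K]_n).

Let mul_w0 A i j : (w0 *m A) i j = (-1) ^+ i * A (rev_ord i) j.
Proof.
rewrite mxE (bigD1 (rev_ord i)) //= big1 ?addr0 => [|s /negbTE sp]; rewrite w0E.
  by rewrite eqxx mulr1.
by rewrite eq_sym sp mulr0 mul0r.
Qed.

Let mul_mx_w0 A i j : (A *m w0) i j = A i (rev_ord j) * (-1) ^+ rev_ord j.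
Proof.
rewrite mxE (bigD1 (rev_ord j)) //= big1 ?addr0 => [|s sp]; rewrite w0E.
  by rewrite rev_ordK eqxx mulr1.
by rewrite -(inj_eq rev_ord_inj) rev_ordK in sp; rewrite (negbTE sp) !mulr0.
Qed.

Let w0w0 : w0 *m ((-1) ^+ n.-1 *: w0) = 1%:M.
Proof.
apply/matrixP => i j; rewrite -scalemxAr mxE mul_w0 w0E rev_ordK mxE !mulrA -!exprD.
have -> : (n.-1 + i + rev_ord i = n.-1 * 2)%N by rewrite /=; have := ltn_ord i; lia.
by rewrite mulnC exprM sqrrN !expr1n mul1r.
Qed.

Let w0_unit : w0 \in unitmx. Proof. by case: (mulmx1_unit w0w0). Qed.

Let w0V : invmx w0 = (-1) ^+ n.-1 *: w0.
Proof. by rewrite -[LHS]mulmx1 -w0w0 mulKmx. Qed.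

Let w0_conj A : Bminus A -> Bplus (w0 *m A *m invmx w0).
Proof.
move=> [uA hA]; split=> [|i j ji]; first by rewrite !unitmx_mul w0_unit uA unitmx_inv.
rewrite w0V -scalemxAr mxE mul_mx_w0 mul_w0 hA ?mulr0 ?mul0r ?mulr0 //=.
by have := ltn_ord i; lia.
Qed.

Let w0_conjV A : Bplus A -> Bminus (invmx w0 *m A *m w0).
Proof.
move=> [uA hA]; split=> [|i j ji]; first by rewrite !unitmx_mul w0_unit uA unitmx_inv w0_unit.
rewrite w0V -!scalemxAl mxE mul_mx_w0 mul_w0 hA ?mulr0 ?mul0r ?mulr0 //=.
by have := ltn_ord j; lia.
Qed.

Lemma wP_invmx_w0 : wP *m invmx w0 = pivotmx K n k.
Proof. by rewrite wPE mulmxK. Qed.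

Lemma Zset_cell b : Zset wP w0 b <-> cell k b.
Proof. by rewrite /Zset /cell /= wP_invmx_w0. Qed.

Lemma piL_fiso : @fiso K (Z_space wP w0) (Xcirc_space K n k) (piL k).
Proof.
have coset g g' : @GL K n g -> rcosetmx (@parabolic K n k) g = rcosetmx (@parabolic K n k) g' ->
    exists p, [/\ p \in unitmx, block_upper (n - k) p & g' = p *m g].
  by move=> _ /rcoset_parabolicP [p /parabolicP [up hp] ->]; exists p.
apply: (@fiso_fquot K n _ (rcosetmx (@parabolic K n k)) (@Xcirc K n k) (Zset wP w0) id
  (section_num hk) (section_den hk)).
- exact: mxpolymap_id.
- by move=> i j; exact: section_num_poly.
- by move=> i j; exact: section_den_poly.
- move=> g g' gG _ /(coset _ _ gG) [p [up hp ->]] gd; split.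
    by move=> i j; rewrite /section_den pminor_unit_neq0 //; exact: gd.
  by rewrite -/(section_mx hk g) -/(section_mx hk (p *m g)) section_mxM.
- move=> b /Zset_cell bc; have [[bB [u1 [u2 [u1U u2U bE]]]]] := (bc, bc).
  have ub : b \in unitmx by case: bB.
  have nz i : (i <= n)%N -> pmu k i b != 0 by exact: (cell_pmu_neq0 hk bB u1U u2U bE).
  split=> //.
  + by exists b; split=> // i /andP[_ /nz].
  + by move=> i j; rewrite section_denE nz.
  + exact: section_mx_cell.
move=> _ [g [gG -> gd]].
have den r : pminor hk r (pivot k r) g != 0 by rewrite -pmu_pminor gd //=.
exists (section_mx hk g); first by apply/Zset_cell; exact: section_mx_in_cell.
apply/rcoset_parabolicP; exists (section_mx hk g *m invmx g); first exact: section_mx_coset.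
by rewrite mulmxKV.
Qed.

(** The diagonal of b_1 moves through M, becoming D = M^-1 d_1 M, which is diagonal because M is
    monomial; [d] then normalises the diagonal of D b_2. *)
Lemma cell_torus (b1 b2 : 'M[K]_n) : Bplus b1 -> Bplus b2 ->
  exists d : 'rV[K]_n, [/\ forall i, d 0 i != 0 & exists u1 u2, [/\ Uplus u1, Uplus u2 &
    b1 *m pivotmx K n k *m b2 *m diag_mx d = u1 *m pivotmx K n k *m u2]].
Proof.
move=> b1B b2B; pose M := pivotmx K n k; have MM : M *m M^T = 1%:M by exact: pivotmx_tr.
pose d1 : 'rV[K]_n := \row_i b1 i i.
have d10 i : d1 0 i != 0 by rewrite mxE Bplus_diag_neq0.
have d1B := diag_mx_Bplus d10; have ud1 : diag_mx d1 \in unitmx by case: d1B.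
pose D := M^T *m diag_mx d1 *m M.
have DB : Bplus D.
  have [uM uMT] := mulmx1_unit MM.
  split; first by rewrite !unitmx_mul uM uMT ud1.
  move=> i j ji; rewrite /D mul_mx_diag mxE big1 // => r _; rewrite !mxE.
  case: eqP => [->|_]; last by rewrite mulr0 !mul0r.
  by rewrite -val_eqE /= gtn_eqF // !mulr0.
have XB : Bplus (D *m b2) by exact: BplusM.
have X0 i := Bplus_diag_neq0 i XB.
pose d2 : 'rV[K]_n := \row_i ((D *m b2) i i)^-1.
have d20 i : d2 0 i != 0 by rewrite mxE invr_eq0 X0.
exists d2; split=> //; exists (b1 *m invmx (diag_mx d1)), (D *m b2 *m diag_mx d2); split.
- split=> [|i]; first by apply: BplusM => //; exact: BplusV.
  have := Bplus_diagM i (BplusM b1B (BplusV d1B)) d1B; rewrite mulmxKV // => E.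
  by apply: (mulIf (d10 i)); move: E; rewrite [diag_mx _ _ _]mxE eqxx mulr1n => <-; rewrite mul1r mxE.
- split=> [|i]; first by apply: BplusM => //; exact: diag_mx_Bplus.
  rewrite Bplus_diagM //; last exact: diag_mx_Bplus.
  by rewrite [diag_mx _ _ _]mxE eqxx mulr1n [d2 _ _]mxE mulfV.
rewrite /D -/M !mulmxA; congr (_ *m _ *m _).
by rewrite -(mulmxA (b1 *m _) M) MM mulmx1 mulmxKV.
Qed.

Lemma cell_in_Rich (q : K) b : q != 0 -> cell k b -> Rich wP w0 (piR w0 (torusP n k q *m b)).
Proof.
move=> q0 [bB [u1 [u2 [[u1B _] [u2B _] bE]]]].
exists (torusP n k q *m b *m w0); split=> //.
  exists (torusP n k q *m u1), (invmx w0 *m u2 *m w0); split.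
  - by apply: BplusM => //; exact: torusP_Bplus.
  - exact: w0_conjV.
  - by rewrite bE -wP_invmx_w0 !mulmxA.
exists (torusP n k q *m b), 1%:M; split; [|exact: Bminus1|by rewrite mulmx1].
by apply: BminusM => //; exact: torusP_Bminus.
Qed.

Lemma Rich_cell (q : K) y : q != 0 -> Rich wP w0 y ->
  exists2 b, cell k b & y = piR w0 (torusP n k q *m b).
Proof.
move=> q0 [g [-> [b1 [b1' [b1B b1B' gE]]] [c [c' [cB cB' gE']]]]].
have uc' : c' \in unitmx by case: cB'.
(* Comparing the two Bruhat decompositions of g puts [c] in B_- and in B_+ M B_+, since w_0
   conjugates B_- into B_+. *)
have cE : c = b1 *m pivotmx K n k *m (w0 *m (b1' *m invmx c') *m invmx w0).
  have -> : c = g *m invmx c' *m invmx w0 by rewrite gE' mulmxK // mulmxK.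
  by rewrite gE wPE !mulmxA.
have b2B := w0_conj (BminusM b1B' (BminusV cB')).
have qV0 : q^-1 != 0 by rewrite invr_eq0.
have [d [d0 [u1 [u2 [u1U u2U E]]]]] := cell_torus (BplusM (torusP_Bplus n k qV0) b1B) b2B.
have dM := diag_mx_Bminus d0.
exists (torusP n k q^-1 *m c *m diag_mx d).
  split; first by apply: BminusM => //; apply: BminusM => //; exact: torusP_Bminus.
  by exists u1, u2; split=> //; rewrite -E cE !mulmxA.
rewrite /piR -(mulmxA (torusP n k q^-1)) torusPVK //; apply/lcoset_BminusP.
exists (invmx c' *m (invmx w0 *m diag_mx d *m w0)).
  by apply: BminusM; [exact: BminusV | apply: w0_conjV; exact: diag_mx_Bplus].
by rewrite gE' !mulmxA mulmxK // mulmxK.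
Qed.

(** Changing g in its coset multiplies g w_0^-1 on the right by an element of B_+. The reflection
    makes this a left multiplication by B_+, contained in P, under which [section_mx] is
    invariant. *)
Lemma piR_torus_fiso (q : K) : q != 0 ->
  @fiso K (Z_space wP w0) (Rich_space wP w0) (fun b => piR w0 (torusP n k q *m b)).
Proof.
move=> q0; pose back g := antitr (torusP n k q^-1 *m g *m invmx w0).
have back_poly : mxpolymap back.
  move=> i j; have := mxpolymap_mulmx (torusP n k q^-1) (invmx w0) (rev_ord j) (rev_ord i).
  by apply: mxpolyfun_ext => g; rewrite [RHS]mxE.
have backE b : back (torusP n k q *m b *m w0) = antitr b.
  by rewrite /back -(mulmxA (torusP n k q)) torusPV // mulmxK.
have ratE g : \matrix_(i, j) (section_num hk (rev_ord j) (rev_ord i) (back g) /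
    section_den hk (rev_ord j) (rev_ord i) (back g)) = antitr (section_mx hk (back g)).
  by apply/matrixP => i j; rewrite !mxE.
apply: (@fiso_fquot K n _ (lcosetmx (@Bminus K n)) (Rich wP w0) (Zset wP w0)
  (fun b => torusP n k q *m b *m w0)
  (fun i j g => section_num hk (rev_ord j) (rev_ord i) (back g))
  (fun i j g => section_den hk (rev_ord j) (rev_ord i) (back g))).
- exact: mxpolymap_mulmx.
- by move=> i j; exact: (mxpolyfun_comp back_poly (@section_num_poly K n k hk (rev_ord j) (rev_ord i))).
- by move=> i j; exact: (mxpolyfun_comp back_poly (@section_den_poly K n k hk (rev_ord j) (rev_ord i))).
- move=> g g' gG _ /lcoset_BminusP [p pB ->] gd.
  have backM : back (g *m p) = antitr (w0 *m p *m invmx w0) *m back g.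
    by rewrite /back -antitrM !mulmxA mulmxKV.
  have [up /upper_block hp] := antitr_Bplus (w0_conj pB).
  rewrite !ratE backM; split; last by rewrite section_mxM.
  by move=> i j; rewrite /section_den pminor_unit_neq0 //; exact: (gd i j).
- move=> b /Zset_cell bc; rewrite ratE backE.
  have ac := antitr_cell hk bc; have [aB [u1 [u2 [u1U u2U aE]]]] := ac.
  have ub : b \in unitmx by case: bc => -[].
  split.
  + by rewrite /GL /= !unitmx_mul w0_unit ub andbT; case: (torusP_Bplus n k q0) => ->.
  + exact: cell_in_Rich.
  + by move=> i j; rewrite section_denE (cell_pmu_neq0 hk aB u1U u2U aE).
  + by rewrite section_mx_cell // antitrK.
by move=> y /(Rich_cell q0) [b bc ->]; exists b; [exact/Zset_cell | ].
Qed.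

Lemma piR_torus_inj (q : K) b b' : q != 0 -> cell k b -> cell k b' ->
  piR w0 (torusP n k q *m b) = piR w0 (torusP n k q *m b') -> b = b'.
Proof.
move=> q0 /Zset_cell Zb /Zset_cell Zb' E.
have [_ [psi [_ psiK _]]] := piR_torus_fiso q0.
by rewrite -(psiK _ Zb) -(psiK _ Zb') E.
Qed.

Lemma piR_fiso : @fiso K (Z_space wP w0) (Rich_space wP w0) (piR w0).
Proof.
have := piR_torus_fiso (oner_neq0 K); congr fiso; apply/funext => b.
by rewrite torusP1 mul1mx.
Qed.

End Isomorphisms.

(** * Complex logarithms and branches *)

Section ComplexExponential.
Variable R : realType.
Implicit Types z w : R[i].

Lemma expC0 : expC 0 = 1 :> R[i].
Proof. by apply/eqP; rewrite eq_complex /= expR0 cos0 sin0 mulr1 mulr0 !eqxx. Qed.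

Lemma expCD z w : expC (z + w) = expC z * expC w.
Proof.
case: z w => [a b] [c d]; apply/eqP; rewrite eq_complex /= expRD cosD sinD.
by apply/andP; split; apply/eqP; ring.
Qed.

Lemma expC_neq0 z : expC z != 0.
Proof.
apply/eqP => z0; have := expCD z (- z); rewrite subrr expC0 z0 mul0r => /eqP.
by rewrite oner_eq0.
Qed.

Lemma expCB z w : expC (z - w) = expC z / expC w.
Proof. by apply: (mulIf (expC_neq0 w)); rewrite -expCD subrK divfK // expC_neq0. Qed.

Lemma expC_surj z : z != 0 -> exists w, expC w = z.
Proof.
case: z => x y; rewrite eq_complex /= negb_and => z0.
pose n2 := x ^+ 2 + y ^+ 2.
have n2_gt0 : 0 < n2.
  rewrite lt_def addr_ge0 ?sqr_ge0 // andbT paddr_eq0 ?sqr_ge0 // !sqrf_eq0 negb_and.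
  exact: z0.
pose r := Num.sqrt n2; have r_gt0 : 0 < r by rewrite sqrtr_gt0.
have r0 : r != 0 by rewrite gt_eqF.
have r2 : r ^+ 2 = n2 by rewrite sqr_sqrtr // ltW.
pose u := x / r; pose v := y / r.
have uv : u ^+ 2 + v ^+ 2 = 1.
  by rewrite /u /v !expr_div_n -mulrDl r2 divff // gt_eqF.
have u1 : -1 <= u <= 1.
  rewrite -ler_norml -(@expr_le1 _ 2) // ?normr_ge0 // real_normK ?num_real //.
  by rewrite -uv lerDl sqr_ge0.
have cu : cos (acos u) = u by rewrite acosK.
have su : sin (acos u) = `|v|.
  by rewrite sin_acos // -uv addrC addKr sqrtr_sqr.
have rK t : r * (t / r) = t by rewrite mulrC divfK.
(* Polar form: [acos] gives an angle with nonnegative sine, so the sign of the imaginary part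
   selects the angle or its opposite. *)
exists (ln r +i* (if 0 <= v then acos u else - acos u)).
apply/eqP; rewrite eq_complex /= lnK ?posrE //; case: leP => v0.
  by rewrite cu su ger0_norm // /u /v !rK !eqxx.
by rewrite cosN sinN cu su ltr0_norm // opprK /u /v !rK !eqxx.
Qed.

End ComplexExponential.

Section Logarithms.
Variables (R : realType) (n : nat).
Implicit Types (H t : 'M[R[i]]_n).

Lemma lnTP t H : lnT (torus_part t) H <->
  (forall i j, i != j -> H i j = 0) /\ (forall i, expC (H i i) = t i i).
Proof.
rewrite /lnT /=; split=> [[/is_diag_mxP Hd E]|[Hd E]]; split=> //.
- by move=> i; move/matrixP: E => /(_ i i); rewrite !mxE eqxx.
- exact/is_diag_mxP.
- by apply/matrixP => i j; rewrite !mxE E.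
Qed.

Lemma torus_part1 : torus_part 1%:M = 1%:M :> 'M[R[i]]_n.
Proof. by apply/matrixP => i j; rewrite !mxE eqxx. Qed.

(** Two logarithms of one torus element differ by a period, so a nonempty set of them fills the
    whole fibre modulo periods. Comparing potentials thus requires only inclusion and
    nonemptiness. *)
Lemma mod_periods_lnT (A : set (R[i] * 'M[R[i]]_n)) w t :
    (forall v, A v -> v.1 = w /\ lnT (torus_part t) v.2) -> (exists v, A v) ->
  mod_periods A = [set v | v.1 = w /\ lnT (torus_part t) v.2]%classic.
Proof.
move=> Asub [v0 Av0]; apply/seteqP; split=> [_ [v [H [Av +] ->]]|[v1 v2] /= [-> tv]].
  rewrite -torus_part1 => /lnTP [Hd HE] /=; have [-> /lnTP [vd vE]] := Asub _ Av.
  split=> //; apply/lnTP; split=> [i j ij|i]; rewrite mxE; first by rewrite vd // Hd // addr0.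
  by rewrite expCD vE HE mxE eqxx mulr1.
have [v0w /lnTP [v0d v0E]] := Asub _ Av0; move: tv => /lnTP [vd vE].
exists v0, (v2 - v0.2); split=> //; last by rewrite v0w addrC subrK.
rewrite -torus_part1; apply/lnTP; split=> [i j ij|i]; rewrite !mxE.
  by rewrite vd // v0d // subr0.
by rewrite expCB vE -v0E divff ?expC_neq0 // eqxx.
Qed.

End Logarithms.

(** * Equality of the equivariant potentials *)

Section EquivariantPotential.
Variables (R : realType) (n k : nat) (hk : (1 <= k <= n.-1)%N).
Variables (wP w0 : 'M[R[i]]_n).
Hypothesis w0E : forall i j : 'I_n, w0 i j = (-1) ^+ i * (rev_ord i == j)%:R.
Hypothesis wPE : wP = pivotmx R[i] n k *m w0.
Implicit Types (b g u : 'M[R[i]]_n) (q : R[i]).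

(* Extends the choice of logarithms by ln p_(mu_0) = ln p_(mu_n) = 0. *)
Let lnp (lp : 'I_n.-1 -> R[i]) (i : nat) : R[i] := \sum_(l : 'I_n.-1 | l.+1 == i) lp l.

Let lnpP g (lp : 'I_n.-1 -> R[i]) (i : nat) :
    pmu k n g = 1 -> (forall l, expC (lp l) = pmu k l.+1 g) ->
  (i <= n)%N -> expC (lnp lp i) = pmu k i g.
Proof.
move=> gn lpE le_in; have [i0|i0] := eqVneq i 0%N.
  by rewrite /lnp big_pred0 => [|l]; rewrite i0 // expC0 pmu0 gn.
have [-> | lt_in] := eqVneq i n.
  rewrite /lnp big_pred0 => [|l]; first by rewrite expC0 gn.
  by apply/negbTE; have := ltn_ord l; lia.
have li : (i.-1 < n.-1)%N by lia.
rewrite /lnp (big_pred1 (Ordinal li)) => [|l].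
  by rewrite lpE /= prednK // lt0n.
by rewrite /= -val_eqE /=; lia.
Qed.

(** Summation by parts: each coefficient is a logarithm of p_(mu_i) / p_(mu_(i+1)), times q in the
    first n - k places, that is, of a diagonal entry of torusP(q) b. *)
Let log_coef lq (lp : 'I_n.-1 -> R[i]) (i j : 'I_n) :
  (lq *: (\sum_(s < n | (s < n - k)%N) epsv R[i] s)
   + \sum_(l < n.-1) lp l *: (epsv R[i] (shi l) - epsv R[i] (slo l))) i j =
  if i == j then (if (i < n - k)%N then lq else 0) + (lnp lp i - lnp lp i.+1) else 0.
Proof.
rewrite mxE [X in X + _]mxE [X in _ + X]summxE summxE.
have -> : \sum_(s < n | (s < n - k)%N) epsv R[i] s i j
          = if (i == j) && (i < n - k)%N then 1 else 0.
  case: ifP => [/andP[/eqP <- im]|ij].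
    rewrite (bigD1 i) //= big1 ?addr0 => [|s /andP[_ /negbTE si]]; rewrite mxE ?eqxx //.
    by rewrite eq_sym si.
  rewrite big1 // => s sm; rewrite mxE; case: eqP => //= is_; case: eqP => //= js.
  by move: ij; rewrite is_ js eqxx sm.
have -> : \sum_(l < n.-1) (lp l *: (epsv R[i] (shi l) - epsv R[i] (slo l))) i j
    = if i == j then lnp lp i - lnp lp i.+1 else 0.
  case: eqP => [<-|/eqP ij].
    rewrite /lnp !(big_mkcond (fun l : 'I_n.-1 => _ == _)) -sumrB; apply: eq_bigr => l _.
    rewrite !mxE -!val_eqE /= !andbb eqSS ![_ == (i : nat)]eq_sym.
    by do !case: (_ == _); rewrite ?subrr ?subr0 ?sub0r ?mulr1 ?mulr0 ?mulrN1.
  rewrite big1 // => l _; rewrite !mxE.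
  have z (s : 'I_n) : (i == s) && (j == s) = false.
    by apply/negbTE/andP => -[/eqP is_ /eqP js]; move: ij; rewrite is_ js eqxx.
  by rewrite !z subrr mulr0.
case: (i == j) => /=; last by rewrite mulr0 addr0.
by case: ifP; rewrite ?mulr1 ?mulr0.
Qed.

Lemma torusP_mul q b i j :
  (torusP n k q *m b) i j = (if (i < n - k)%N then q else 1) * b i j.
Proof. by rewrite mul_diag_mx !mxE. Qed.

Let Weq_spec q b v : q != 0 -> cell k b -> Weq k (@epsv R[i] n) (piL k b) q v ->
  v.1 = superpotential k b q /\ lnT (torus_part (torusP n k q *m b)) v.2.
Proof.
move=> q0 bc [g [lq [lp [[[p hp <-] gn] lqE lpE ->]]]] /=.
have [bB [u1 [u2 [u1U u2U bE]]]] := bc.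
have [up bp] := (parabolicP k p).1 hp.
(* Both the representative and [b] have p_(mu_n) = 1, so they have the same Plücker coordinates. *)
have det1 : \det (corner hk p) = 1.
  by have := pmuM hk b (leqnn n) bp; rewrite gn (cell_pmu_last hk bB u1U u2U bE) mulr1.
have pmuE i : (i <= n)%N -> pmu k i (p *m b) = pmu k i b.
  by move=> le_in; rewrite (pmuM hk) // det1 mul1r.
split; first exact: (superpotentialM (hk := hk)).
apply/lnTP; split=> [i j /negbTE ij|i]; rewrite log_coef ?ij // eqxx torusP_mul.
rewrite expCD expCB !(lnpP gn lpE) ?(ltnW (ltn_ord i)) // !pmuE ?(ltnW (ltn_ord i)) //.
rewrite -(cell_diag hk bB u1U u2U bE) mulfK ?(cell_pmu_neq0 hk bB u1U u2U bE) //.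
by congr (_ * _); case: ifP; rewrite ?expC0.
Qed.

Let Weq_neq0 q b : q != 0 -> cell k b -> exists v, Weq k (@epsv R[i] n) (piL k b) q v.
Proof.
move=> q0 [bB [u1 [u2 [u1U u2U bE]]]].
have [lq lqE] := expC_surj q0.
have ex (l : 'I_n.-1) : exists z, expC z = pmu k l.+1 b.
  apply: expC_surj; apply: (cell_pmu_neq0 hk bB u1U u2U bE).
  by have := ltn_ord l; lia.
have [lp lpE] := boolp.choice ex.
eexists; exists b, lq, lp; split=> //; split; last exact: (cell_pmu_last hk bB u1U u2U bE).
by exists 1%:M; [apply: Bplus_parabolic; exact: Bplus1 | rewrite mul1mx].
Qed.

Let torus_conj q u : q != 0 -> Uplus u -> Uplus (torusP n k q^-1 *m u *m torusP n k q).
Proof.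
move=> q0 [uB u1].
have TB := torusP_Bplus n k q0.
have TVB : Bplus (torusP n k q^-1) by apply: torusP_Bplus; rewrite invr_eq0.
split=> [|i]; first by apply: BplusM => //; exact: BplusM.
rewrite !Bplus_diagM //; last exact: BplusM.
by rewrite u1 mulr1 -Bplus_diagM // torusPM mulVf // torusP1 mxE eqxx.
Qed.

(** Injectivity of b -> torusP(q) b w_0 B_- on the cell identifies the element b' allowed in [Feq],
    so its value does not depend on choices. *)
Let Feq_decomp q b b' u1 u2 : q != 0 -> cell k b ->
    Bminus b' -> Uplus u1 -> Uplus u2 ->
    b' = u1 *m torusP n k q *m (wP *m invmx w0) *m u2 ->
    piR w0 (torusP n k q *m b) = piR w0 b' ->
  b' = torusP n k q *m b /\ simple_sum u1 + simple_sum u2 = superpotential k b q.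
Proof.
move=> q0 bc bB' u1U u2U bE' piE.
have qV0 : q^-1 != 0 by rewrite invr_eq0.
pose v1 := torusP n k q^-1 *m u1 *m torusP n k q.
have v1U : Uplus v1 by exact: torus_conj.
have TbE : torusP n k q^-1 *m b' = v1 *m pivotmx R[i] n k *m u2.
  by rewrite bE' (wP_invmx_w0 hk w0E wPE) /v1 !mulmxA.
have TbB : Bminus (torusP n k q^-1 *m b') by apply: BminusM => //; exact: torusP_Bminus.
have E : b = torusP n k q^-1 *m b'.
  apply: (piR_torus_inj hk w0E wPE q0) => //; last by rewrite torusPVK.
  by split=> //; exists v1, u2.
split; first by rewrite E torusPVK.
rewrite E (cell_superpotential hk TbB v1U u2U TbE) !simple_sum_superdiag addrC.
congr (_ + _); apply: eq_bigr => r _; rewrite /superdiag mulr_suml; apply: eq_bigr => s /eqP sr.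
rewrite /v1 -mulmxA torusP_mul mul_mx_diag !mxE sr.
(* Conjugation by torusP(q) rescales only the superdiagonal entry between rows of different
   blocks. *)
case: eqP => [<-|rm]; first by rewrite ltnSn ltnn mulr1 mulrC mulrA mulfV // mul1r.
have -> : (r.+1 < n - k)%N = (r < n - k)%N by lia.
by case: ifP => _; rewrite ?mulr1 ?mul1r // mulrCA mulVf // mulr1.
Qed.

Lemma Weq_Feq q b : q != 0 -> cell k b ->
  mv_eq (Weq k (@epsv R[i] n) (piL k b) q) (Feq k wP w0 (piR w0 (torusP n k q *m b)) q).
Proof.
move=> q0 bc; have [v Wv] := Weq_neq0 q0 bc.
have Wsub v' := @Weq_spec q b v' q0 bc.
have [bB [u1 [u2 [u1U u2U bE]]]] := bc.
rewrite /mv_eq (mod_periods_lnT Wsub); last by exists v.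
rewrite (@mod_periods_lnT _ _ _ (superpotential k b q) (torusP n k q *m b)) //.
  move=> _ [b' [v1 [v2 [H [[bB' v1U v2U bE'] piE HE ->]]]]] /=.
  by have [<- ->] := Feq_decomp q0 bc bB' v1U v2U bE' piE.
have [_ HE] := Wsub _ Wv; have qV0 : q^-1 != 0 by rewrite invr_eq0.
eexists; exists (torusP n k q *m b), (torusP n k q *m u1 *m torusP n k q^-1), u2, v.2.
split=> //; split=> //.
- by apply: BminusM => //; exact: torusP_Bminus.
- by have := torus_conj qV0 u1U; rewrite invrK.
- by rewrite (wP_invmx_w0 hk w0E wPE) bE -!mulmxA torusPV.
Qed.

End EquivariantPotential.

(** With [epsv] as parameters the coefficients are logarithms of the diagonal entries of torusP(q)
    b; the opposite sign would give those of the inverse. At the point [piR w0 b] itself, q would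
    multiply the entry (k, k+1) of u_2 (1-based) instead of the entry (n-k, n-k+1) of u_1. *)
Theorem proposition5p1 (R : realType) (n k : nat) (hk : (1 <= k <= n.-1)%N)
    (rP r0 : seq 'I_n.-1)
    (hP : longest_word (@lettersP n k) rP)
    (h0 : longest_word xpredT r0) :
  let wP := worddot R[i] rP in
  let w0 := worddot R[i] r0 in
  [/\ @fiso R[i] (Z_space wP w0) (Xcirc_space R[i] n k) (piL k),
      @fiso R[i] (Z_space wP w0) (Rich_space wP w0) (piR w0) &
      forall q : R[i], q != 0 ->
        @fiso R[i] (Z_space wP w0) (Rich_space wP w0)
          (fun b => piR w0 (torusP n k q *m b)) /\
        (forall b : 'M[R[i]]_n, Zset wP w0 b ->
          mv_eq (Weq k (@epsv R[i] n) (piL k b) q)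
                (Feq k wP w0 (piR w0 (torusP n k q *m b)) q))].
Proof.
move=> wP w0.
have w0E (i j : 'I_n) : w0 i j = (-1) ^+ i * (rev_ord i == j)%:R.
  rewrite /w0 (@longest_worddot n 0 (leq0n n) _ r0 h0) /= subn0 -val_eqE /=.
  by rewrite subnS -subn1 subnAC subn1.
(* In the top rows the factor (-1)^k of M offsets the shift of the row index by k in the sign of
   w_0. *)
have wPE : wP = pivotmx R[i] n k *m w0.
  apply/matrixP => i j; rewrite mul_pivotmx w0E.
  rewrite /wP (@longest_worddot n (n - k) (leq_subr k n) _ rP hP).
  rewrite /pivot_sign -val_eqE /= val_pivot // mulrA; have lt_in := ltn_ord i.
  case: ifP => im; last by rewrite mul1r; congr (_ * (_ == _)%:R); lia.
  rewrite -exprD addnCA addnn -mul2n exprD exprM sqrrN !expr1n mulr1.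
  by congr (_ * (_ == _)%:R); lia.
split; [exact: piL_fiso | exact: (piR_fiso hk) |].
move=> q q0; split; first exact: (piR_torus_fiso hk).
by move=> b /(Zset_cell hk w0E wPE) bc; exact: Weq_Feq.
Qed.
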